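(* Let $q=2^m$ with $m\ge 1$, and let $n\ge 4$ be even. Then $$N_q(n/2,n;\,m+1)=\Bigl(q^{\binom n{n/2}-1}+(q-1)q^{\frac 12\binom n{n/2}-1}\Bigr)q^{\dim_{\mathbb F_q}R_q(n/2,n)-\binom n{n/2}},$$ where $$\dim_{\mathbb F_q}R_q(n/2,n)=\sum_{0\le j\le\lfloor n/(2q)\rfloor}(-1)^j\binom nj\binom{\frac{3n}2-qj}n.$$
   Context: For a prime power $q=p^m$ ($p$ prime) and integers $n>0$, $0\le d\le n(q-1)$, the $q$-ary Reed-Muller code is $$R_q(d,n)=\{f\in\mathbb F_q[X_1,\dots,X_n]:\deg f\le d,\ \deg_{X_j}f\le q-1 \text{ for } 1\le j\le n\},$$ where $\deg$ is the total degree and $\deg_{X_j}$ is the degree in $X_j$ (the zero polynomial is included). The weight of $f\in R_q(d,n)$ is $|f|=q^n-|Z(f)|$, where $Z(f)=\{\boldsymbol x\in\mathbb F_q^n:f(\boldsymbol x)=0\}$. For $t\ge 0$, $N_q(d,n;t)=|\{f\in R_q(d,n):\nu_p(|f|)\ge t\}|$, where $\nu_p$ is the $p$-adic valuation ($\nu_p(0)=\infty$); that is, the number of codewords with weight divisible by $p^t$. *)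

(* Defs.v *)
From HB Require Import structures.
From mathcomp Require Import all_boot all_order all_algebra all_field.
From mathcomp Require Import mpoly.

Set Implicit Arguments.
Unset Strict Implicit.
Unset Printing Implicit Defensive.

Import GRing.Theory.
Local Open Scope ring_scope.

(* The degree of f in 'X_j (0 if f = 0). *)
Definition mdeg_in (R : nzRingType) (n : nat) (j : 'I_n) (f : {mpoly R[n]}) :
  nat := (\max_(m <- msupp f) m j)%N.

(* As [msize f] is [deg f + 1], or 0 if f = 0, [msize f <= d.+1] says that f is
   zero or has total degree at most d. *)
Definition rm_pred (F : finFieldType) (d n : nat) : {pred {mpoly F[n]}} :=
  [pred f : {mpoly F[n]} |
    (msize f <= d.+1)%N && [forall j : 'I_n, (mdeg_in j f <= #|F|.-1)%N]].
Arguments rm_pred : clear implicits.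

Definition rm_mnm (F : finFieldType) (d n : nat) :=
  {m : 'X_{1..n < d.+1} | [forall j : 'I_n, (m j <= #|F|.-1)%N]}.

Lemma rm_predP (F : finFieldType) (d n : nat) (f : {mpoly F[n]}) :
  reflect (forall m, m \in msupp f ->
             (mdeg m < d.+1)%N /\ [forall j : 'I_n, (m j <= #|F|.-1)%N])
          (f \in rm_pred F d n).
Proof.
apply: (iffP andP) => [[degf /forallP degjf] m mf|H].
  split; first exact: leq_trans (msize_mdeg_lt mf) degf.
  apply/forallP => j; apply: leq_trans (degjf j).
  by rewrite /mdeg_in (big_rem m mf) /= leq_maxl.
split.
  by rewrite msizeE; apply/bigmax_leqP_seq => m mf _; case: (H m mf).
apply/forallP => j; apply/bigmax_leqP_seq => m mf _.
by case: (H m mf) => _ /forallP.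
Qed.

Lemma rm_submod_closed (F : finFieldType) (d n : nat) :
  submod_closed (rm_pred F d n).
Proof.
split=> [|c f g /rm_predP Hf /rm_predP Hg];
  first by apply/rm_predP => m; rewrite msupp0.
apply/rm_predP => m /msuppD_le; rewrite mem_cat => /orP[/msuppZ_le|].
  exact: Hf.
exact: Hg.
Qed.

HB.instance Definition _ (F : finFieldType) (d n : nat) :=
  GRing.isSubmodClosed.Build F {mpoly F[n]} (rm_pred F d n)
    (@rm_submod_closed F d n).

Section ReedMuller.
Variables (F : finFieldType) (d n : nat).

(* The code R_q(d, n), with q = #|F|. *)
Record reed_muller :=
  ReedMuller { rm_poly :> {mpoly F[n]}; _ : rm_poly \in rm_pred F d n }.

HB.instance Definition _ := [isSub for rm_poly].
HB.instance Definition _ := [Choice of reed_muller by <:].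
HB.instance Definition _ := [SubChoice_isSubLmodule of reed_muller by <:].

Lemma rm_vecaxiom : Vector.axiom #|{: rm_mnm F d n}| reed_muller.
Proof.
pose M (i : 'I_(#|{: rm_mnm F d n}|)) : 'X_{1..n} := bmnm (val (enum_val i)).
have injM : injective M by move=> i j /val_inj/val_inj/enum_val_inj.
pose g (r : 'rV[F]_(#|{: rm_mnm F d n}|)) : {mpoly F[n]} :=
  \sum_i r 0 i *: 'X_[M i].
have rmg r : g r \in rm_pred F d n.
  apply: rpred_sum => i _; apply: rpredZ; apply/rm_predP => m.
  rewrite msuppX inE => /eqP->; split; first exact: bmdeg.
  exact: (valP (enum_val i)).
have gM r i : (g r)@_(M i) = r 0 i.
  rewrite /g raddf_sum (bigD1 i) //= mcoeffZ mcoeffX eqxx mulr1 big1 ?addr0 //.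
  by move=> k ki; rewrite mcoeffZ mcoeffX (inj_eq injM) (negbTE ki) mulr0.
exists (fun f : reed_muller => \row_i (rm_poly f)@_(M i)) => [c p q|].
  by apply/rowP => i; rewrite !mxE /= mcoeffD mcoeffZ.
exists (fun r => ReedMuller (rmg r)) => [f|r]; last first.
  by apply/rowP => i; rewrite mxE /= gM.
apply/val_inj/mpolyP => m /=.
have [/existsP[i /eqP->]|/existsPn noM] := boolP [exists i, m == M i].
  by rewrite gM mxE.
rewrite /g raddf_sum big1 => [|i _]; last first.
  by rewrite /= mcoeffZ mcoeffX eq_sym (negbTE (noM i)) mulr0.
apply/esym/memN_msupp_eq0/negP => mf.
have [dm jm] := elimT (rm_predP d _) (valP f) m mf.
pose x : rm_mnm F d n := exist _ (BMultinom dm) jm.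
by have := noM (enum_rank x); rewrite /M enum_rankK eqxx.
Qed.

HB.instance Definition _ :=
  Lmodule_hasFinDim.Build F reed_muller rm_vecaxiom.

HB.instance Definition _ :=
  isCountable.Build reed_muller
    (pcan_pickleK (can_pcan VectorInternalTheory.v2rK)).
HB.instance Definition _ :=
  isFinite.Build reed_muller
    (pcan_enumP (can_pcan
      (VectorInternalTheory.v2rK : @cancel _ reed_muller _ _))).

End ReedMuller.

Definition zeros (F : finFieldType) (n : nat) (f : {mpoly F[n]}) :
  {set {ffun 'I_n -> F}} := [set x : {ffun 'I_n -> F} | f.@[x] == 0].

Definition weight (F : finFieldType) (n : nat) (f : {mpoly F[n]}) : nat :=
  (#|F| ^ n - #|zeros f|)%N.

(* nu_p(w) >= t, with nu_p(0) = oo (whereas [logn p 0 = 0]). *)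
Definition val_ge (p w t : nat) : bool := (w == 0)%N || (t <= logn p w)%N.

(* N_q(d, n; t); as q = #|F| is a power of p, p is the least prime factor of
   q. *)
Definition rm_count (F : finFieldType) (d n t : nat) : nat :=
  #|[set f : reed_muller F d n | val_ge (pdiv #|F|) (weight f) t]|.

(* Main.v *)
Require Import Defs.
From HB Require Import structures.
From mathcomp Require Import all_boot all_order all_algebra all_field.
From mathcomp Require Import all_fingroup all_solvable.
From mathcomp Require Import mpoly zify ring.

Set Implicit Arguments.
Unset Strict Implicit.
Unset Printing Implicit Defensive.

Import GRing.Theory Num.Theory.
Import Pdiv.CommonRing Pdiv.RingMonic.
Local Open Scope ring_scope.

(** Write q = 2 ^ m and n = 2 k, and let f be a codeword of degree at most k,
    with coefficients c_y indexed by its monomials y.  Ax's theorem says that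
    q divides the weight of f; the point is to compute the next binary digit
    of the weight.

    Let A be a commutative ring in which 2 is regular and with A / 2 A = F, such
    as the ring of integers of an unramified extension ([integral_lift]).  Lift the
    coefficients and lift the points of F through approximate Teichmueller
    representatives T.  If ft is the lift of f and E = (q - 1) q, then ft(x) ^ E
    is 0 or 1 modulo 2 q according as f(x) is 0 or not, so that the weight of f
    is the sum over x of ft(x) ^ E, modulo 2 q A.  By the multinomial theorem
    this is a sum over exponent vectors j of total E of
      multinomial(j) * prod_y lift(c_y) ^ (j_y) * prod_i S(d_i),
    where d_i is the sum over y of j_y * deg_i(y), and S(d) is the sum over F of
    T ^ d: it is q for d = 0, it vanishes modulo 2 q if q - 1 does not divide d,
    and it reduces to 1 in F otherwise.  By Legendre's formula the 2-adic
    valuation of the multinomial coefficient is the number of binary digits 1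
    in the j_y, minus m.  A positive multiple of q - 1 is not a sum of fewer
    than m powers of 2, and m of them are congruent modulo q - 1 to the powers
    1, 2, ..., 2 ^ (m - 1), each once ([mersenne_digit_sum]).  Since every
    monomial has degree at most k = n / 2, all terms are divisible by q, and by
    2 q except for the [tight] ones, where no d_i vanishes and the j_y have
    exactly 2 m digits 1.

    In a tight term only squarefree monomials y of degree k occur, and the
    digits of j at y and at the complementary monomial tau(y) are at the same
    positions modulo m.  So j -> j o tau is an involution of the tight vectors
    which preserves the monomial prod_y c_y ^ (j_y); in characteristic 2 only
    its fixed points contribute.  These are the vectors on a set H of
    representatives of the pairs {y, tau(y)} with total E / 2 and m digits 1,
    that is, with an odd multinomial coefficient: so the tight terms add up to
    Q(c) ^ (E / 2), where Q(c) is the sum over y in H of c_y * c_(tau y)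
    ([tight_sum]).  Hence 2 q divides the weight of f if and only if Q(c) = 0
    ([dvdn_card_support]).

    It remains to count the zeros of the hyperbolic quadratic form Q
    ([card_pairing_zeros]) and the monomials of the code
    ([card_bounded_vectors]). *)

(** * A characteristic zero lift of a finite field of characteristic 2 *)

Lemma finfield_generator (F : finFieldType) :
  exists2 g : F, (#|F|.-1).-primitive_root g
               & forall x, x != 0 -> exists i, x = g ^+ i.
Proof.
have /cyclicP[u Gu] : cyclic [set: {unit F}] by exact: field_unit_group_cyclic.
have gu i : val (u ^+ i)%g = val u ^+ i.
  by elim: i => [|i IH]; rewrite ?expgS ?exprS //= -IH.
have ou : #[u]%g = #|F|.-1 by rewrite orderE -Gu card_finField_unit.
exists (val u).
  have o0 : (0 < #[u]%g)%N by exact: order_gt0.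
  rewrite -ou; apply/andP; split=> //; apply/forallP => i; rewrite unity_rootE.
  rewrite -gu -[1]/(val (1%g : {unit F})) (inj_eq val_inj) -order_dvdn.
  apply/eqP; apply/idP/eqP => [/dvdn_leq le|->] //.
  by apply/anti_leq; rewrite le // ltn_ord.
move=> x; rewrite -unitfE => xU.
have /cycleP[i ui] : FinRing.unit F xU \in <[u]>%g by rewrite -Gu inE.
by exists i; rewrite -gu -ui.
Qed.

Lemma intr_pchar2 (R : nzRingType) (z : int) :
  2%N \in [pchar R] -> z%:~R = (odd `|z|)%:R :> R.
Proof.
move=> ch2; have natE (k : nat) : k%:R = (odd k)%:R :> R.
  rewrite -[in LHS](odd_double_half k) natrD -muln2 natrM.
  by rewrite (pcharf0 ch2) mulr0 addr0.
case: z => k; first exact: natE.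
by rewrite NegzE mulrNz oppr_pchar2 // abszN; apply: natE.
Qed.

(** The ring is Z[X] / (h), with h monic of least degree among the integer
    polynomials that vanish at a generator g of the multiplicative group of F.
    A polynomial of smaller degree that vanishes at g has even coefficients:
    otherwise its reduction modulo 2, cut at the last odd coefficient, lifts to
    a monic polynomial that contradicts the choice of h. *)
Lemma integral_lift (F : finFieldType) : 2%N \in [pchar F] ->
  exists (A : comNzRingType) (pi : {rmorphism A -> F}),
    [/\ forall x, exists a, pi a = x,
        forall a, pi a = 0 -> exists b, a = b *+ 2
      & forall a : A, a *+ 2 = 0 -> a = 0].
Proof.
move=> ch2; have [g gprim ggen] := finfield_generator F.
have int_comm : commr_rmorph (intr : int -> F) g by move=> z; apply: mulrC.
pose ev : {rmorphism {poly int} -> F} := horner_morph int_comm.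
have evX : ev 'X = g by rewrite /ev /= horner_morphX.
have evZ a (p : {poly int}) : ev (a *: p) = a%:~R * ev p.
  by rewrite -mul_polyC rmorphM /= horner_morphC.
have evE (p : {poly int}) s : (size p <= s)%N -> ev p = \sum_(i < s) (odd `|p`_i|)%:R * g ^+ i.
  move=> /take_poly_id {1}<-; rewrite /take_poly poly_def rmorph_sum.
  by apply: eq_bigr => i _; rewrite /= evZ rmorphXn /= evX (intr_pchar2 _ ch2).
(* A monic polynomial vanishing at g may be taken with lower coefficients 0 or 1,
   which makes the choice of the least degree s decidable. *)
pose P s := [exists b : {ffun 'I_s -> bool},
  g ^+ s + \sum_(i < s) (b i)%:R * g ^+ i == 0].
have exP : exists s, P s.
  have q1 : (0 < #|F|.-1)%N by apply: prim_order_gt0 gprim.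
  (* X ^ (q - 1) + 1 vanishes at g, as 1 = -1 in F. *)
  exists #|F|.-1; apply/existsP; exists [ffun i => i == Ordinal q1].
  rewrite (bigD1 (Ordinal q1)) //= ffunE eqxx mul1r big1 => [|i /negPf ni].
    by rewrite (prim_expr_order gprim) addr0 -[1 + 1]/(2%:R) (pcharf0 ch2).
  by rewrite ffunE ni mul0r.
case: (ex_minnP exP) => s /existsP[b /eqP evb] smin.
have s_gt0 : (0 < s)%N.
  case: (s) b evb => // b; rewrite big_ord0 expr0 addr0 => /eqP.
  by rewrite oner_eq0.
pose h : {poly int} := 'X^s + \poly_(i < s) (if insub i is Some j then (b j : nat)%:Z else 0).
have szl : (size (\poly_(i < s) (if insub i is Some j then (b j : nat)%:Z else 0))
   < size ('X^s : {poly int}))%N.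
  by rewrite size_polyXn ltnS size_poly.
have szh : size h = s.+1 by rewrite size_polyDl // size_polyXn.
have hmon : h \is monic by rewrite monicE lead_coefDl // lead_coefXn.
have evh : ev h = 0.
  rewrite rmorphD /= rmorphXn /= evX -[RHS]evb; congr (_ + _).
  rewrite (@evE _ s) ?size_poly //; apply: eq_bigr => i _.
  by rewrite coef_poly ltn_ord valK /= oddb.
have mkh : mk_monic h = h by rewrite /mk_monic hmon szh ltnS s_gt0.
have szmk : size (mk_monic h) = s.+1 by rewrite mkh.
have ev_mod p : ev (rmodp p (mk_monic h)) = ev p.
  by rewrite mkh {2}(rdivp_eq hmon p) rmorphD rmorphM /= evh mulr0 add0r.
pose pi (a : {poly %/ h}) := ev (a : {poly int}).
have pi_zmod : zmod_morphism pi by move=> x y; rewrite /pi rmorphB.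
have pi_mon : monoid_morphism pi.
  split=> [|x y]; first exact: (rmorph1 ev).
  by rewrite /pi poly_of_qpolyM ev_mod rmorphM.
pose piZ := GRing.isZmodMorphism.Build _ _ pi pi_zmod.
pose piM := GRing.isMonoidMorphism.Build _ _ pi pi_mon.
pose piR : {rmorphism {poly %/ h} -> F} := HB.pack pi piZ piM.
have piE a : piR a = ev (a : {poly int}) by [].
exists {poly %/ h}, piR; split=> [x|a|a].
- have [->|/ggen[i ->]] := eqVneq x 0; first by exists 0; rewrite rmorph0.
  by exists (in_qpoly h 'X^i); rewrite piE /= ev_mod rmorphXn /= evX.
- rewrite piE => eva0.
  have sza : (size (a : {poly int}) <= s)%N.
    by rewrite -ltnS -szmk; apply: size_mk_monic.
  have evn i : ~~ odd `|(a : {poly int})`_i|.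
    have [si|si] := leqP (size (a : {poly int})) i; first by rewrite nth_default.
    apply/negP => oi.
    have exo : exists i, (odd `|(a : {poly int})`_i|) && (i < s)%N.
      by exists i; rewrite oi (leq_trans si).
    have ubo j : (odd `|(a : {poly int})`_j|) && (j < s)%N -> (j <= s)%N.
      by case/andP => _ /ltnW.
    case: (ex_maxnP exo ubo) => t /andP[ot ts] tmax.
    suff /smin : P t by rewrite leqNgt ts.
    apply/existsP; exists [ffun j : 'I_t => odd `|(a : {poly int})`_j|].
    rewrite -[X in _ == X]eva0 (evE _ s sza).
    rewrite -(big_mkord xpredT (fun j => (odd `|(a : {poly int})`_j|)%:R * g ^+ j)).
    rewrite (big_cat_nat (leq0n t) (ltnW ts)) /=; apply/eqP; rewrite [LHS]addrC; congr (_ + _).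
      by rewrite big_mkord; apply: eq_bigr => j _; rewrite ffunE.
    rewrite big_ltn // ot mul1r big_nat big1 ?addr0 // => j /andP[tj js].
    have /negPf-> : ~~ odd `|(a : {poly int})`_j|; last by rewrite mul0r.
    by apply/negP => oj; move: (tmax j); rewrite oj js leqNgt tj => /(_ isT).
  pose c := \poly_(i < s) ((a : {poly int})`_i %/ 2)%Z.
  have szc : (size c < size (mk_monic h))%N by rewrite szmk ltnS size_poly.
  exists (in_qpoly h c); apply/val_inj/polyP => i.
  rewrite raddfMn /= coefMn rmodp_small // coef_poly.
  case: ltnP => [_|si]; last by rewrite nth_default // (leq_trans sza).
  by rewrite pmulrn mulrzz divzK // dvdzE dvdn2 evn.
- move=> /(congr1 val) a20; apply/val_inj/polyP => i.
  move/polyP/(_ i): a20; rewrite raddfMn coefMn coef0 => /eqP.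
  by rewrite mulrn_eq0 => /eqP.
Qed.

(** * Multinomial coefficients and binary digits *)

Lemma big_tupleS (R : Type) (idx : R) (op : Monoid.com_law idx) (I : finType)
    (N : nat) (f : N.+1.-tuple I -> R) :
  \big[op/idx]_t f t
    = \big[op/idx]_i \big[op/idx]_(t : N.-tuple I) f [tuple of i :: t].
Proof.
rewrite pair_bigA /=.
rewrite (reindex (fun p : I * N.-tuple I => [tuple of p.1 :: p.2])) //=.
exists (fun t => (thead t, [tuple of behead t])) => [[i t] _|t _] /=.
  by congr (_, _); apply: val_inj.
by rewrite [RHS]tuple_eta; apply: val_inj.
Qed.

(** The multinomial coefficient N! / prod_i (j i)!, for j of sum N, as the number
    of words of length N with j i letters i: it thus comes with the expansion of
    a power of a sum, and no division is involved. *)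
Definition multinomial (I : finType) (N : nat) (j : I -> nat) : nat :=
  \sum_(t : N.-tuple I | [forall i, count_mem i t == j i]) 1.

(** By induction on the first letter of the words. *)
Lemma multinomial_fact (I : finType) (N : nat) (j : I -> nat) :
  (\sum_i j i = N -> multinomial N j * \prod_i (j i)`! = N`!)%N.
Proof.
rewrite /multinomial; elim: N j => [|N IH] j jN.
  have j0 i : j i = 0%N.
    by apply/eqP; rewrite -leqn0 -jN (bigD1 i) //= leq_addr.
  rewrite [X in (_ * X)%N]big1 ?muln1 => [|i _]; last by rewrite j0.
  rewrite (eq_bigl xpredT) => [|t]; last first.
    by apply/forallP => i; rewrite tuple0 j0.
  by rewrite sum1_card card_tuple expn0.
rewrite big_mkcond big_tupleS /= factS -jN !big_distrl /=.
apply: eq_bigr => i _; rewrite -big_mkcond /=.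
case: (posnP (j i)) => [ji0|ji].
  rewrite ji0 mul0n big1 // => t /forallP/(_ i) /=.
  by rewrite eqxx ji0.
pose j' l := (j l - (l == i))%N.
have j'i : (j' i).+1 = j i by rewrite /j' eqxx subn1 prednK.
have j'n l : l != i -> j' l = j l by move=> /negPf li; rewrite /j' li subn0.
have jN' : (\sum_l j' l = N)%N.
  apply/eqP; rewrite -eqSS -jN; apply/eqP.
  rewrite (bigD1 i) // [in RHS](bigD1 i) //= -addSn j'i; congr (_ + _)%N.
  by apply: eq_bigr => l /j'n.
rewrite -(IH _ jN') (bigD1 i) //= [in RHS](bigD1 i) //= -j'i factS.
rewrite (eq_bigr (fun l => (j' l)`!)) => [|l /j'n-> //].
rewrite (eq_bigl (fun t : N.-tuple I => [forall l, count_mem l t == j' l])).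
  by ring.
move=> t; apply: eq_forallb => l /=; rewrite /j' (eq_sym l i).
case: (i =P l) => [<-|_]; last by rewrite subn0 add0n.
by rewrite -[RHS](eqn_add2l 1) subnKC.
Qed.

Lemma prod_count_mem (R : comPzRingType) (I : finType) (z : I -> R) (s : seq I) :
  \prod_(x <- s) z x = \prod_i z i ^+ count_mem i s.
Proof.
elim: s => [|x s IH]; first by rewrite big_nil big1.
rewrite big_cons IH [in RHS](bigD1 x) //= [in LHS](bigD1 x) //= eqxx exprS mulrA.
by congr (_ * _); apply: eq_bigr => i /negPf xi; rewrite eq_sym xi.
Qed.

(** The bound B on the exponents is independent of N, so that expansions with
    different powers can be indexed by the same finite type. *)
Lemma multinomial_expansion (R : comPzRingType) (I : finType) (z : I -> R)
    (N B : nat) : (N <= B)%N ->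
  (\sum_i z i) ^+ N =
    \sum_(j : {ffun I -> 'I_B.+1} | (\sum_i j i == N)%N)
      (multinomial N (fun i => j i))%:R * \prod_i z i ^+ j i.
Proof.
move=> NB.
have -> : (\sum_i z i) ^+ N = \sum_(t : N.-tuple I) \prod_(x <- t) z x.
  elim: N {NB} => [|N IH].
    rewrite expr0 (eq_bigr (fun=> 1)) => [|t _]; last by rewrite tuple0 big_nil.
    by rewrite sumr_const card_tuple expn0.
  rewrite exprS IH big_tupleS /= mulr_suml; apply: eq_bigr => i _.
  by rewrite mulr_sumr; apply: eq_bigr => t _; rewrite big_cons.
have cB (t : N.-tuple I) i : (count_mem i t < B.+1)%N.
  by rewrite ltnS (leq_trans (count_size _ _)) // size_tuple.
have csum (t : N.-tuple I) : (\sum_i count_mem i t = N)%N.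
  rewrite -[RHS](size_tuple t) -sum1_size; elim: (t : seq I) => [|x s IH].
    by rewrite big1 ?big_nil.
  rewrite big_cons -IH /= big_split /= (bigD1 x) //= eqxx big1 // => i.
  by rewrite eq_sym => /negPf->.
rewrite (partition_big (fun t : N.-tuple I => [ffun i => Ordinal (cB t i)])
  (fun j : {ffun I -> 'I_B.+1} => \sum_i j i == N)%N) /= => [|t _]; last first.
  by apply/eqP; rewrite -[RHS](csum t); apply: eq_bigr => i _; rewrite ffunE.
apply: eq_bigr => j _; rewrite /multinomial natr_sum mulr_suml.
apply: eq_big => [t|t /eqP<-]; last first.
  by rewrite mul1r prod_count_mem; apply: eq_bigr => i _; rewrite ffunE.
apply/eqP/forallP => [<- i|H]; first by rewrite ffunE.
by apply/ffunP => i; rewrite ffunE; apply: val_inj; apply/eqP; apply: H.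
Qed.

Definition bit (a p : nat) : bool := odd (a %/ 2 ^ p).

Definition bitsum (a : nat) : nat := (\sum_(p < a) bit a p)%N.

Lemma div_bit (a p : nat) : (a %/ 2 ^ p = bit a p + (a %/ 2 ^ p.+1).*2)%N.
Proof. by rewrite expnSr divnMA divn2 odd_double_half. Qed.

(** Legendre's formula: the floors a / 2 ^ p telescope against their doubles, up to
    the digits. *)
Lemma logn_fact_bitsum (a : nat) : (logn 2 a`! + bitsum a = a)%N.
Proof.
rewrite logn_fact // big_add1 /= big_mkord /bitsum.
suff : (\sum_(p < a) a %/ 2 ^ p = a - 0 + \sum_(p < a) a %/ 2 ^ p.+1)%N.
  under eq_bigr do rewrite div_bit -muln2.
  by rewrite big_split /= -big_distrl /=; lia.
case: (posnP a) => [->|a0]; first by rewrite !big_ord0.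
rewrite -(prednK a0) big_ord_recl expn0 divn1 [in RHS]big_ord_recr /=.
rewrite [X in (_ + (_ + X))%N]divn_small ?addn0 ?subn0 //.
exact: ltn_expl.
Qed.

(** Kummer's theorem for the prime 2; the coefficient is odd when no carry occurs. *)
Lemma multinomial_bitsum (I : finType) (N : nat) (j : I -> nat) :
  (\sum_i j i = N ->
   0 < multinomial N j /\
   logn 2 (multinomial N j) + bitsum N = \sum_i bitsum (j i))%N.
Proof.
move=> jN; have /[dup] eN := multinomial_fact jN.
have m0 : (0 < multinomial N j)%N.
  by move: (fact_gt0 N); rewrite -eN muln_gt0 => /andP[].
have pr0 : (0 < \prod_i (j i)`!)%N by apply: prodn_gt0 => i; apply: fact_gt0.
move=> /(congr1 (logn 2)); rewrite lognM // => eL; split=> //.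
have lp : (logn 2 (\prod_i (j i)`!) = \sum_i logn 2 (j i)`!)%N.
  apply: (big_ind2 (fun x y => 0 < x -> logn 2 x = y)%N) => //.
  move=> x1 x2 y1 y2 h1 h2; rewrite muln_gt0 => /andP[p1 p2].
  by rewrite lognM // h1 // h2.
have := logn_fact_bitsum N.
have : (\sum_i logn 2 (j i)`! + \sum_i bitsum (j i) = N)%N.
  by rewrite -big_split /= -[RHS]jN; apply: eq_bigr => i _; apply: logn_fact_bitsum.
lia.
Qed.

Lemma bitsum_wide (a L : nat) : (a <= L)%N -> (\sum_(p < L) bit a p = bitsum a)%N.
Proof.
move=> aL; rewrite -!(big_mkord xpredT (fun p => bit a p : nat)) /=.
rewrite /bitsum (big_cat_nat (leq0n a) aL) /= big_mkord.
rewrite [X in (_ + X)%N](_ : _ = 0%N) ?addn0 // big_nat big1 // => p /andP[ap _].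
by rewrite /bit divn_small // (leq_ltn_trans ap) // ltn_expl.
Qed.

Lemma bit_expansion (a : nat) : (a = \sum_(p < a) bit a p * 2 ^ p)%N.
Proof.
have H L : (a = \sum_(p < L) bit a p * 2 ^ p + (a %/ 2 ^ L) * 2 ^ L)%N.
  elim: L => [|L IH]; first by rewrite big_ord0 expn0 divn1 muln1.
  by rewrite big_ord_recr /= {1}IH div_bit -muln2 expnS; ring.
rewrite {1}(H a) [X in (_ + X * _)%N]divn_small ?mul0n ?addn0 //.
exact: ltn_expl.
Qed.

Lemma bitsum_eq0 (a : nat) : (bitsum a == 0)%N = (a == 0)%N.
Proof.
apply/idP/eqP => [|->]; last by rewrite /bitsum big_ord0.
rewrite sum_nat_eq0 => /forallP H; rewrite [LHS]bit_expansion big1 // => p _.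
by have /implyP/(_ isT)/eqP-> := H p.
Qed.

Lemma bitsum_half (a : nat) : (bitsum a = odd a + bitsum a./2)%N.
Proof.
case: (posnP a) => [->|a0]; first by rewrite /bitsum !big_ord0.
rewrite -(@bitsum_wide a a.-1.+1); last by rewrite prednK.
rewrite big_ord_recl /bit expn0 divn1.
rewrite -(@bitsum_wide a./2 a.-1); last by lia.
congr (_ + _)%N.
by apply: eq_bigr => p _; rewrite /bit /= /bump add1n expnS divnMA divn2.
Qed.

Lemma bitsum_mersenne (m s : nat) : bitsum ((2 ^ m - 1) * 2 ^ s) = m.
Proof.
elim: s => [|s IH]; last first.
  rewrite bitsum_half expnS mulnCA mul2n odd_double doubleK.
  exact: IH.
rewrite expn0 muln1; elim: m => [|m IH]; first by rewrite /bitsum big_ord0.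
have e0 : (0 < 2 ^ m)%N by rewrite expn_gt0.
have -> : (2 ^ m.+1 - 1 = 1 + (2 ^ m - 1).*2)%N by rewrite expnS; lia.
rewrite bitsum_half oddD odd_double addbF -/(1 + _)%N.
by have -> : (1 + (2 ^ m - 1).*2)./2 = (2 ^ m - 1)%N; [lia | rewrite IH].
Qed.

(** The digits at positions congruent to b modulo m: modulo 2 ^ m - 1 they all
    have weight 2 ^ b. *)
Definition resbits (m b a : nat) : nat := (\sum_(p < a | p %% m == b) bit a p)%N.

Lemma resbits0 (m b : nat) : resbits m b 0 = 0%N.
Proof. by rewrite /resbits big_ord0. Qed.

Lemma sum_resbits (m a : nat) : (0 < m)%N ->
  (\sum_(b < m) resbits m b a = bitsum a)%N.
Proof.
move=> m0; rewrite /bitsum.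
by rewrite (partition_big (fun p : 'I_a => Ordinal (ltn_pmod p m0)) xpredT).
Qed.

Lemma eq_modn_sum (I : finType) (P : pred I) (d : nat) (f g : I -> nat) :
  (forall i, P i -> f i = g i %[mod d]) ->
  (\sum_(i | P i) f i = \sum_(i | P i) g i %[mod d])%N.
Proof.
move=> fg; rewrite -modn_summ -[RHS]modn_summ; congr (_ %% _)%N.
exact: eq_bigr.
Qed.

Lemma resbits_mod (m a : nat) : (0 < m)%N ->
  (\sum_(b < m) resbits m b a * 2 ^ b = a %[mod 2 ^ m - 1])%N.
Proof.
move=> m0; have e0 : (0 < 2 ^ m)%N by rewrite expn_gt0.
have e1 : (2 ^ m = 1 %[mod 2 ^ m - 1])%N.
  by rewrite -{1}(subnK e0) modnDl.
rewrite [a in RHS]bit_expansion.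
rewrite (partition_big (fun p : 'I_a => Ordinal (ltn_pmod p m0)) xpredT) //=.
apply: eq_modn_sum => b _; rewrite /resbits big_distrl /=.
apply: eq_modn_sum => p /eqP pb; rewrite -modnMmr -[RHS]modnMmr; congr (_ * _ %% _)%N.
have e : (2 ^ (p %/ m * m) = 1 %[mod 2 ^ m - 1])%N.
  by rewrite mulnC expnM -modnXm e1 modnXm exp1n.
by rewrite [in RHS](divn_eq p m) pb expnD -[in RHS]modnMml e modnMml mul1n.
Qed.

(** Two copies of 2 ^ b can be traded for one copy of the cyclically next power
    without changing the sum modulo 2 ^ m - 1.  Each trade decreases the number
    of terms by one, and the process can only end with each power occurring
    once, as a sum with all N b <= 1 is at most 2 ^ m - 1. *)
Lemma mersenne_digit_sum (m : nat) (N : 'I_m -> nat) : (0 < m)%N ->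
  (0 < \sum_b N b * 2 ^ b)%N -> (2 ^ m - 1 %| \sum_b N b * 2 ^ b)%N ->
  (m < \sum_b N b)%N \/ (forall b, N b = 1%N).
Proof.
move=> m0; have e0 : (0 < 2 ^ m)%N by rewrite expn_gt0.
have [s] := ubnP (\sum_b N b); elim: s N => // s IH N.
rewrite ltnS => Ns N0 dN.
have [/forallP N1|] := boolP [forall b, (N b <= 1)%N]; last first.
  rewrite negb_forall => /existsP[b]; rewrite -ltnNge => Nb; left.
  pose c := ordS b; pose N' l := (N l - 2 * (l == b) + (l == c))%N.
  have sum1 (a : 'I_m) (w : 'I_m -> nat) : (\sum_l (l == a) * w l = w a)%N.
    rewrite (bigD1 a) //= eqxx mul1n big1 ?addn0 // => l /negPf->.
    by rewrite mul0n.
  have carry (w : 'I_m -> nat) :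
      (\sum_l N' l * w l + 2 * w b = \sum_l N l * w l + w c)%N.
    rewrite -(sum1 b) -(sum1 c) big_distrr -!big_split /=; apply: eq_bigr => l _.
    rewrite /N' mulnDl mulnA addnAC -mulnDl subnK //.
    by case: eqP => // ->.
  have V0 : (0 < \sum_l N' l * 2 ^ l)%N.
    rewrite (bigD1 c) //= addn_gt0 muln_gt0 expn_gt0 /= andbT.
    by rewrite /N' eqxx addn1.
  have sN : (\sum_l N' l + 1 = \sum_l N l)%N.
    have := carry (fun=> 1%N); under eq_bigr do rewrite muln1.
    by under [in RHS]eq_bigr do rewrite muln1; lia.
  have dV : (2 ^ m - 1 %| \sum_l N' l * 2 ^ l)%N.
    have := carry (fun l => 2 ^ l)%N.
    have [cb|cb] : (2 ^ c = 2 * 2 ^ b \/ 2 ^ c + (2 ^ m - 1) = 2 * 2 ^ b)%N.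
    - have [bm|bm] := ltnP b.+1 m; [left|right].
        by rewrite /= modn_small // expnS.
      have bm' : b.+1 = m by apply/eqP; rewrite eqn_leq bm ltn_ord.
      by rewrite /= bm' modnn -expnS bm' expn0 subnKC.
    - by rewrite cb => /addIn->.
    move=> eV; have {eV} : (\sum_l N' l * 2 ^ l + (2 ^ m - 1)
        = \sum_l N l * 2 ^ l)%N by lia.
    by move: dN => /[swap] <-; rewrite dvdn_addl.
  case: (IH N') => // [|lt|all1]; first by lia.
    by lia.
  by rewrite -sN (eq_bigr (fun=> 1%N)) // sum1_card card_ord addn1.
right; have sum2 : (\sum_(b < m) 2 ^ b = 2 ^ m - 1)%N.
  by rewrite subn1 predn_exp mul1n.
have le b : (N b * 2 ^ b <= 2 ^ b)%N by rewrite -[leqRHS]mul1n leq_mul2r N1 orbT.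
have eqs : (\sum_b N b * 2 ^ b = \sum_(b < m) 2 ^ b)%N.
  apply/anti_leq; rewrite leq_sum => [|b _]; last exact: le.
  by rewrite sum2 dvdn_leq.
move=> b; have/eqP := eqs.
have [_ ->] := leqif_sum (fun b (_ : true) => leqif_eq (le b)).
move=> /forallP/(_ b)/=; rewrite -{2}[(2 ^ b)%N]mul1n eqn_mul2r.
by rewrite -leqn0 leqNgt expn_gt0 /= => /eqP.
Qed.

(** * The dominant terms of the expansion *)

Lemma sum_involution_pchar2 (R : nzRingType) (J : finType) (P : pred J)
    (f : J -> J) (G : J -> R) :
  2%N \in [pchar R] -> involutive f -> (forall j, P j -> P (f j)) ->
  (forall j, P j -> G (f j) = G j) ->
  \sum_(j | P j) G j = \sum_(j | P j && (f j == j)) G j.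
Proof.
move=> ch2 fK Pf Gf; rewrite (bigID (fun j => f j == j)) /=.
have PfE j : P (f j) = P j by apply/idP/idP => /Pf //; rewrite fK.
rewrite [X in _ + X](bigID (fun j => enum_rank j < enum_rank (f j))%N) /=.
rewrite [X in _ + (_ + X)](reindex_inj (inv_inj fK)) /=.
rewrite [X in _ + (_ + X)](eq_big (fun j => P j && (f j != j)
    && (enum_rank j < enum_rank (f j))%N) G) => [|j|j].
- by rewrite addrr_pchar2 ?addr0.
- rewrite PfE fK eq_sym -leqNgt leq_eqVlt -andbA -[RHS]andbA; congr (_ && _).
  case: (f j =P j) => //= fj; rewrite orbC.
  rewrite (inj_eq val_inj) (inj_eq enum_rank_inj) eq_sym.
  by case: (f j =P j) fj => //; rewrite orbF.
- by case/andP => /andP[+ _] _; rewrite PfE; apply: Gf.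
Qed.

(** The index x : I stands for a monomial with exponent e x i in the variable i,
    and j x for the exponent of this monomial in a term of the expansion of a
    power of a polynomial. *)
Section Tight.

Variables (I : finType) (n k m : nat) (e : I -> 'I_n -> nat).
Hypotheses (m_gt0 : (0 < m)%N) (k_gt1 : (1 < k)%N) (nk : n = k.*2).
Hypothesis deg_le : forall x, (\sum_i e x i <= k)%N.

Definition expo (j : I -> nat) (i : 'I_n) : nat := (\sum_x j x * e x i)%N.

(** The terms of least valuation, namely m, in the expansion of the weight. *)
Definition tight (j : I -> nat) : bool :=
  (\sum_x bitsum (j x) == 2 * m)%N
  && [forall i, (0 < expo j i)%N && (2 ^ m - 1 %| expo j i)%N].

Lemma sum_digit_cover (j : I -> nat) (i : 'I_n) :
  (\sum_(b < m) \sum_x resbits m b (j x) * e x i = \sum_x bitsum (j x) * e x i)%N.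
Proof.
rewrite exchange_big; apply: eq_bigr => x _.
by rewrite -big_distrl /= sum_resbits.
Qed.

(** The digits of the j x, counted with multiplicity e x i, write expo j i as a sum
    of powers of 2 modulo 2 ^ m - 1. *)
Lemma digit_cover (j : I -> nat) (i : 'I_n) :
  (0 < expo j i)%N -> (2 ^ m - 1 %| expo j i)%N ->
  (m < \sum_x bitsum (j x) * e x i)%N
  \/ (forall b : 'I_m, \sum_x resbits m b (j x) * e x i = 1)%N.
Proof.
move=> e0 de; pose N (b : 'I_m) := (\sum_x resbits m b (j x) * e x i)%N.
have sN : (\sum_b N b = \sum_x bitsum (j x) * e x i)%N by apply: sum_digit_cover.
have vN : (\sum_b N b * 2 ^ b = expo j i %[mod 2 ^ m - 1])%N.
  under eq_bigr do rewrite big_distrl /=.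
  rewrite exchange_big; apply: eq_modn_sum => x _ /=.
  under eq_bigr do rewrite mulnAC.
  by rewrite -big_distrl /= -modnMml resbits_mod // modnMml.
have N0 : (0 < \sum_b N b * 2 ^ b)%N.
  rewrite lt0n; apply: contraTneq e0 => /eqP; rewrite sum_nat_eq0 => /forallP V0.
  have S0 : (\sum_x bitsum (j x) * e x i = 0)%N.
    rewrite -sN big1 // => b _; have := V0 b.
    by rewrite implyTb muln_eq0 expn_eq0 orbF => /eqP.
  rewrite -leqNgt leqn0 sum_nat_eq0; apply/forallP => x.
  move/eqP: S0; rewrite sum_nat_eq0 => /forallP/(_ x).
  by rewrite !implyTb !muln_eq0 bitsum_eq0.
rewrite -sN; apply: mersenne_digit_sum => //.
by rewrite /dvdn vN.
Qed.

Lemma cover_ge (j : I -> nat) (i : 'I_n) :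
  (0 < expo j i)%N -> (2 ^ m - 1 %| expo j i)%N ->
  (m <= \sum_x bitsum (j x) * e x i ?= iff
     [forall b : 'I_m, \sum_x resbits m b (j x) * e x i == 1])%N.
Proof.
move=> e0 de; have := digit_cover e0 de.
have sN := sum_digit_cover j i; case=> [lt|all1].
  split; first exact: ltnW.
  rewrite (ltn_eqF lt); apply/esym/negbTE; apply: contraL lt => /forallP all1.
  rewrite -sN (eq_bigr (fun=> 1%N)) => [|b _]; last by apply/eqP.
  by rewrite sum1_card card_ord ltnn.
rewrite -sN (eq_bigr (fun=> 1%N)) => [|b _]; last by apply: all1.
rewrite sum1_card card_ord; split=> //; rewrite eqxx; apply/esym/forallP => b.
by rewrite all1.
Qed.

Lemma sum_cover_le (j : I -> nat) :
  (\sum_i \sum_x bitsum (j x) * e x i <= k * \sum_x bitsum (j x) ?= iff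
    [forall x, (j x == 0) || (\sum_i e x i == k)])%N.
Proof.
rewrite exchange_big big_distrr /=.
apply: leqif_sum => x _; rewrite -big_distrr /= mulnC.
by split; rewrite ?leq_mul2r ?deg_le ?orbT // eqn_mul2r bitsum_eq0.
Qed.

(** Ax's bound with its equality case.  Every variable with nonzero exponent
    uses at least m digits, each digit is used by at most k variables, and a
    variable with exponent zero contributes a factor q, that is m to the
    valuation, which outweighs the m / k digits that it saves, as k > 1. *)
Lemma tight_or_small (j : I -> nat) :
  (forall i, (0 < expo j i)%N -> (2 ^ m - 1 %| expo j i)%N) ->
  tight j || (2 * m < \sum_x bitsum (j x) + m * #|[pred i | expo j i == 0%N]|)%N.
Proof.
move=> de; set z := #|_|; set W := (\sum_x bitsum (j x))%N.
have cz : (#|[pred i | expo j i != 0%N]| + z = n)%N.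
  by rewrite addnC /z -[RHS]card_ord -(cardC [pred i | expo j i == 0%N]).
have low : (m * #|[pred i | expo j i != 0%N]| <= k * W)%N.
  apply: leq_trans (sum_cover_le j).
  rewrite (bigID [pred i | expo j i != 0%N]) /= (leq_trans _ (leq_addr _ _)) //.
  rewrite mulnC -sum_nat_const; apply: leq_sum => i; rewrite inE -lt0n => e0.
  by apply: cover_ge e0 (de i e0).
case: (ltnP (2 * m) (W + m * z)) => [_|Wz]; first by rewrite orbT.
rewrite orbF; have z0 : z = 0%N by nia.
apply/andP; split.
  apply/eqP/anti_leq; move: Wz cz low; rewrite z0 muln0 !addn0 -/W => -> ->.
  have -> : (m * n = k * (2 * m))%N by rewrite nk -mul2n; ring.
  by rewrite leq_pmul2l // ltnW.
apply/forallP => i; suff e0 : (0 < expo j i)%N by rewrite e0 de.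
rewrite lt0n; apply/negP => ei0.
by move/card0_eq: z0 => /(_ i); rewrite inE ei0.
Qed.

(** In the tight case all the inequalities behind the bound are equalities. *)
Lemma tight_equalities (j : I -> nat) : tight j ->
  [forall x, (j x == 0) || (\sum_i e x i == k)]%N
  /\ forall i b, (b < m)%N -> (\sum_x resbits m b (j x) * e x i = 1)%N.
Proof.
case/andP=> /eqP W /forallP pos.
have low i : (m <= \sum_x bitsum (j x) * e x i ?= iff
     [forall b : 'I_m, \sum_x resbits m b (j x) * e x i == 1])%N.
  by have /andP[e0 de] := pos i; apply: cover_ge.
have [_ H] := leqif_trans (leqif_sum (fun i (_ : true) => low i)) (sum_cover_le j).
have nm : (n * m = k * (2 * m))%N by rewrite nk -mul2n; ring.
move: H; rewrite sum_nat_const card_ord W nm eqxx.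
move=> /esym/andP[/forallP all1 sqfree_top]; split=> // i b bm.
by have /forallP/(_ (Ordinal bm))/eqP := all1 i.
Qed.

Definition sqfree_top (x : I) : bool := (\sum_i e x i == k)%N && [forall i, (e x i <= 1)%N].

Lemma tight_sqfree_top (j : I -> nat) (x : I) : tight j -> j x != 0%N -> sqfree_top x.
Proof.
move=> tj jx; have [/forallP/(_ x) degx all1] := tight_equalities tj.
move: degx; rewrite (negPf jx) /= /sqfree_top => -> /=; apply/forallP => i.
have : bitsum (j x) != 0%N by rewrite bitsum_eq0.
rewrite -(sum_resbits _ m_gt0) sum_nat_eq0 negb_forall => /existsP[b] /=.
have := all1 i b (ltn_ord b); rewrite (bigD1 x) //=; nia.
Qed.

Variable tau : I -> I.
Hypotheses (e_inj : forall x y, e x =1 e y -> x = y) (tauK : involutive tau).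
Hypothesis e_tau : forall x i, sqfree_top x -> e (tau x) i = (1 - e x i)%N.

Lemma sqfree_top_tau (x : I) : sqfree_top x -> sqfree_top (tau x).
Proof.
move=> tx; apply/andP; split; last first.
  by apply/forallP => i; rewrite e_tau // leq_subr.
have /andP[/eqP dx /forallP le1] := tx.
rewrite (eq_bigr (fun i => 1 - e x i)%N) => [|i _]; last exact: e_tau.
by rewrite sumnB // dx sum1_card card_ord nk -addnn addnK.
Qed.

(** For each b, the monomials with a digit of residue b form a partition of the n = 2 k
    variables into squarefree monomials of degree k: a pair of complementary
    monomials. *)
Lemma resbits_tau (j : I -> nat) (x : I) (b : nat) : tight j -> (b < m)%N ->
  resbits m b (j (tau x)) = resbits m b (j x).
Proof.
move=> tj bm; have [_ all1] := tight_equalities tj.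
have nz y : resbits m b (j y) != 0%N -> j y != 0%N.
  by apply: contraNneq => ->; rewrite resbits0.
have main y : resbits m b (j y) != 0%N ->
    resbits m b (j y) = 1%N /\ resbits m b (j (tau y)) = 1%N.
  move=> ry; have ty := tight_sqfree_top tj (nz y ry).
  have /andP[/eqP dy /forallP le1] := ty.
  (* y has a variable i1, and lacks a variable i0, which must be covered by another w. *)
  have [i1 /eqP ei1] : exists i, e y i == 1%N.
    apply/existsP; apply: contraTT k_gt1; rewrite negb_exists -dy => /forallP ne1.
    rewrite big1 // => i _; have := ne1 i; have := le1 i; lia.
  have [i0 /eqP ei0] : exists i, e y i == 0%N.
    apply/existsP; apply: contraTT k_gt1; rewrite negb_exists => /forallP ne0.
    have : (\sum_i e y i = \sum_(i < n) 1)%N.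
      by apply: eq_bigr => i _; have := ne0 i; have := le1 i; lia.
    by rewrite dy sum1_card card_ord nk; lia.
  split.
    by have := all1 i1 b bm; rewrite (bigD1 y) //= ei1; lia.
  have [w rw ew] : exists2 w, resbits m b (j w) = 1%N & e w i0 = 1%N.
    have /eqP/sum_nat_eq1[w [_ /eqP]] := all1 i0 b bm.
    by rewrite muln_eq1 => /andP[/eqP rw /eqP ew] _; exists w.
  have yw : w != y by apply: contraPneq ew => ->; rewrite ei0.
  have tw : sqfree_top w by apply: tight_sqfree_top tj _; apply: nz; rewrite rw.
  have /andP[/eqP dw _] := tw.
  suff -> : tau y = w by [].
  have le i : (e w i <= 1 - e y i)%N.
    have := all1 i b bm; rewrite (bigD1 y) //= (bigD1 w) //= rw mul1n.
    by have := le1 i; nia.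
  apply: e_inj => i; rewrite e_tau //.
  have : (\sum_i e w i == \sum_i (1 - e y i))%N.
    rewrite dw sumnB // dy sum1_card card_ord nk -addnn addnK //.
  have [_ ->] := leqif_sum (fun i (_ : true) => leqif_eq (le i)).
  by move=> /forallP/(_ i)/eqP.
have [r0|/main[-> ->]//] := eqVneq (resbits m b (j x)) 0%N.
rewrite r0; apply/eqP; apply: contraT => /main[_].
by rewrite tauK r0.
Qed.

Lemma tight_tau (j : I -> nat) : tight j -> tight (fun x => j (tau x)).
Proof.
move=> tj; have [_ all1] := tight_equalities tj.
have /andP[/eqP W _] := tj; apply/andP; split.
  rewrite -W; apply/eqP; rewrite [RHS](reindex_inj (inv_inj tauK)) /=.
  exact: eq_bigr.
apply/forallP => i.
have all1' b : (b < m)%N -> (\sum_x resbits m b (j (tau x)) * e x i = 1)%N.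
  by move=> bm; rewrite -(all1 i b bm); apply: eq_bigr => x _; rewrite resbits_tau.
have vE : (expo (fun x => j (tau x)) i = \sum_(b < m) 2 ^ b %[mod 2 ^ m - 1])%N.
  rewrite [in RHS](eq_bigr (fun b : 'I_m =>
    \sum_x resbits m b (j (tau x)) * e x i * 2 ^ b)%N); last first.
    by move=> b _; rewrite -big_distrl /= all1' ?mul1n.
  rewrite exchange_big; apply: eq_modn_sum => x _ /=.
  under eq_bigr do rewrite mulnAC.
  by rewrite -big_distrl /= -[RHS]modnMml resbits_mod // modnMml.
apply/andP; split; last first.
  rewrite /dvdn vE.
  by rewrite -[(\sum_(b < m) 2 ^ b)%N]mul1n -(predn_exp 2) -subn1 modnn.
have /eqP/sum_nat_eq1[x [_ /eqP]] := all1' 0%N m_gt0.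
rewrite muln_eq1 => /andP[rx /eqP ex] _.
rewrite /expo (bigD1 x) //= ex muln1 addn_gt0 lt0n; apply/orP; left.
by apply: contraTneq rx => ->; rewrite resbits0.
Qed.

Lemma sqfree_top_tauE (x : I) : sqfree_top (tau x) = sqfree_top x.
Proof. by apply/idP/idP => /sqfree_top_tau //; rewrite tauK. Qed.

Variable i0 : 'I_n.

(** One monomial of each complementary pair: the one that involves the variable i0. *)
Definition pair_rep (x : I) : bool := sqfree_top x && (e x i0 == 1%N).

Lemma pair_rep_tau (x : I) : sqfree_top x -> pair_rep (tau x) = ~~ pair_rep x.
Proof.
move=> tx; rewrite /pair_rep sqfree_top_tau // tx e_tau //=.
by have /andP[_ /forallP/(_ i0)] := tx; case: (e x i0) => [|[]].
Qed.

Lemma big_pair_rep (R : Type) (idx : R) (op : Monoid.com_law idx) (G : I -> R) :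
  (forall x, ~~ sqfree_top x -> G x = idx) ->
  \big[op/idx]_x G x = \big[op/idx]_(x | pair_rep x) op (G x) (G (tau x)).
Proof.
move=> G0; rewrite (bigID pair_rep) big_split /=; congr (op _ _).
rewrite (bigID sqfree_top) /= [X in op _ X]big1 => [|x /andP[_ /G0] //].
rewrite Monoid.mulm1 (reindex_inj (inv_inj tauK)) /=; apply: eq_bigl => x.
rewrite sqfree_top_tauE; case tx : (sqfree_top x); last by rewrite andbF /pair_rep tx.
by rewrite pair_rep_tau // negbK andbT.
Qed.

(** The vectors that are invariant under [tau] and supported on squarefree monomials
    of degree k correspond to the vectors supported on [pair_rep]. *)
Definition unfold_rep (B : nat) (l : {ffun I -> 'I_B.+1}) : {ffun I -> 'I_B.+1} :=
  [ffun x => if pair_rep x then l x else if pair_rep (tau x) then l (tau x) else ord0].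

Definition restrict_rep (B : nat) (j : {ffun I -> 'I_B.+1}) : {ffun I -> 'I_B.+1} :=
  [ffun x => if pair_rep x then j x else ord0].

Lemma big_unfold_rep (R : Type) (idx : R) (op : Monoid.com_law idx) (B : nat)
    (l : {ffun I -> 'I_B.+1}) (G : nat -> I -> R) :
  (forall x, G 0%N x = idx) ->
  \big[op/idx]_x G (unfold_rep l x) x
    = \big[op/idx]_(x | pair_rep x) op (G (l x) x) (G (l x) (tau x)).
Proof.
move=> G0; rewrite big_pair_rep => [|x tx]; last first.
  have ttx : ~~ sqfree_top (tau x) by rewrite sqfree_top_tauE.
  by rewrite ffunE /pair_rep (negPf tx) (negPf ttx) /= G0.
apply: eq_bigr => x hx; have tx : sqfree_top x by case/andP: hx.
by rewrite !ffunE tauK pair_rep_tau // hx.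
Qed.

Lemma eq_tight (j j' : I -> nat) : j =1 j' -> tight j = tight j'.
Proof.
move=> jj; rewrite /tight (eq_bigr (fun x => bitsum (j' x))) => [|x _]; last by rewrite jj.
congr (_ && _); apply: eq_forallb => i.
by rewrite /expo (eq_bigr (fun x => j' x * e x i)%N) // => x _; rewrite jj.
Qed.

(** The exponents j x and j (tau x) are congruent modulo q - 1, and vanish
    simultaneously, so they give the same power in a field with q elements. *)
Lemma tight_monomial_tau (R : finFieldType) (c : I -> R) (j : I -> nat) :
  #|R| = (2 ^ m)%N -> tight j ->
  \prod_x c x ^+ j (tau x) = \prod_x c x ^+ j x.
Proof.
move=> cR tj; apply: eq_bigr => x _.
have jmod : (j (tau x) = j x %[mod 2 ^ m - 1])%N.
  rewrite -(resbits_mod (j x) m_gt0) -(resbits_mod (j (tau x)) m_gt0).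
  by congr (_ %% _)%N; apply: eq_bigr => b _; rewrite resbits_tau.
have j0 : (j (tau x) == 0%N) = (j x == 0%N).
  rewrite -(bitsum_eq0 (j x)) -(bitsum_eq0 (j (tau x))).
  rewrite -(sum_resbits (j x) m_gt0) -(sum_resbits (j (tau x)) m_gt0).
  congr (_ == _).
  by apply: eq_bigr => b _; rewrite resbits_tau.
have [->|cx] := eqVneq (c x) 0; first by rewrite !expr0n j0.
have c1 : c x ^+ (2 ^ m - 1) = 1.
  apply: (mulfI cx); rewrite -exprS subn1 prednK ?expn_gt0 // -cR mulr1.
  exact: expf_card.
by rewrite -(expr_mod _ c1) jmod expr_mod.
Qed.

(** Only the tight vectors that are invariant under [tau] contribute, by
    [sum_involution_pchar2].  Folded onto the representatives, they are the vectors of sum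
    E / 2 with m digits 1, which are those with an odd multinomial coefficient
    as E / 2 has m digits 1 itself: these are the terms that survive in
    characteristic 2 in the expansion of the right-hand side. *)
Lemma tight_sum (R : finFieldType) (c : I -> R) :
  2%N \in [pchar R] -> #|R| = (2 ^ m)%N ->
  \sum_(j : {ffun I -> 'I_((2 ^ m - 1) * 2 ^ m).+1} |
        (\sum_x j x == (2 ^ m - 1) * 2 ^ m)%N && tight (fun x => j x))
     \prod_x c x ^+ j x
  = (\sum_(x | pair_rep x) c x * c (tau x)) ^+ ((2 ^ m - 1) * 2 ^ m.-1).
Proof.
move=> ch2 cR; set E := ((2 ^ m - 1) * 2 ^ m)%N; set E2 := ((2 ^ m - 1) * 2 ^ m.-1)%N.
have EE : (E = E2.*2)%N.
  by rewrite /E /E2 -mul2n -{2}(prednK m_gt0) expnS; ring.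
have dE a : (a.*2 == E)%N = (a == E2)%N by rewrite EE -!mul2n eqn_pmul2l.
have E2E : (E2 <= E)%N by rewrite EE -addnn leq_addr.
have M0 : (0 < 2 ^ m - 1)%N by rewrite subn_gt0 -{1}(expn0 2) ltn_exp2l.
have E20 : (0 < E2)%N by rewrite muln_gt0 M0 expn_gt0.
pose f (j : {ffun I -> 'I_E.+1}) := [ffun x => j (tau x)].
have fK : involutive f by move=> j; apply/ffunP => x; rewrite !ffunE tauK.
rewrite (sum_involution_pchar2 ch2 fK) => [|j /andP[jE tj]|j /andP[_ tj]]; first last.
- rewrite -(tight_monomial_tau c cR tj).
  by apply: eq_bigr => x _; rewrite ffunE.
- apply/andP; split.
    apply/eqP; rewrite -[RHS](eqP jE) [RHS](reindex_inj (inv_inj tauK)) /=.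
    by apply: eq_bigr => x _; rewrite ffunE.
  rewrite -(eq_tight (j := fun x => j (tau x))); last by move=> x; rewrite ffunE.
  exact: tight_tau tj.
rewrite (reindex_onto (@unfold_rep E) (@restrict_rep E)) /= => [|j]; last first.
  case/andP=> /andP[_ tj] /eqP/ffunP fj; apply/ffunP => x; rewrite !ffunE.
  case hx: (pair_rep x) => //; case htx: (pair_rep (tau x)).
    by rewrite -[RHS]fj ffunE.
  have [tx|ntx] := boolP (sqfree_top x); first by rewrite pair_rep_tau // hx in htx.
  apply/esym/val_inj/eqP; apply: contraNT ntx; exact: tight_sqfree_top tj.
pose z x := if pair_rep x then c x * c (tau x) else 0.
have -> : \sum_(x | pair_rep x) c x * c (tau x) = \sum_x z x by rewrite big_mkcond.
rewrite (multinomial_expansion z E2E).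
pose T (l : {ffun I -> 'I_E.+1}) := \prod_x z x ^+ l x.
pose A (l : {ffun I -> 'I_E.+1}) :=
  (restrict_rep l == l) && (\sum_x bitsum (l x) == m)%N.
have supp (l : {ffun I -> 'I_E.+1}) (x : I) :
    restrict_rep l == l -> ~~ pair_rep x -> l x = ord0.
  by move=> /eqP/ffunP/(_ x); rewrite ffunE => + /negPf hx; rewrite hx.
transitivity (\sum_(l : {ffun I -> 'I_E.+1} | (\sum_x l x == E2)%N && A l) T l).
  apply: eq_big => [l|l /andP[_ /eqP/ffunP ul]]; last first.
    rewrite (big_unfold_rep _ l (G := fun a x => c x ^+ a)) //.
    rewrite big_mkcond; apply: eq_bigr => x _; rewrite /z; case: ifP => hx.
      by rewrite exprMn.
    by have := ul x; rewrite !ffunE hx => <-; rewrite expr0.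
  have -> : restrict_rep (unfold_rep l) = restrict_rep l.
    by apply/ffunP => x; rewrite !ffunE; case: (pair_rep x).
  have -> : f (unfold_rep l) == unfold_rep l.
    apply/eqP/ffunP => x; rewrite !ffunE tauK.
    have [tx|tx] := boolP (sqfree_top x); first by rewrite pair_rep_tau //; case: (pair_rep x).
    by rewrite /pair_rep sqfree_top_tauE (negPf tx).
  rewrite andbT /A andbCA andbC; case suppl: (restrict_rep l == l) => //=.
  have double (g : nat -> nat) : g 0%N = 0%N ->
      (\sum_x g (unfold_rep l x) = (\sum_x g (l x)).*2)%N.
    move=> g0; rewrite (big_unfold_rep _ l (G := fun a _ => g a)) // -addnn -big_split /=.
    rewrite big_mkcond; apply: eq_bigr => x _; case: ifP => // /negbT hx.
    by rewrite (supp l x) ?suppl // g0.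
  rewrite /tight (double id) // (double bitsum) ?resbits0; last by rewrite /bitsum big_ord0.
  rewrite dE -mul2n eqn_pmul2l //; case: eqP => //= lE2; case: eqP => //= _.
  apply/forallP => i; suff -> : expo (fun x => unfold_rep l x) i = E2.
    by rewrite E20 /E2 dvdn_mulr.
  rewrite /expo (big_unfold_rep _ l (G := fun a x => (a * e x i)%N)) // -lE2.
  rewrite big_mkcond; apply: eq_bigr => x _; case: ifP => [/andP[tx _]|/negbT hx]; last first.
    by rewrite (supp l x) ?suppl.
  rewrite /= -mulnDr e_tau // subnKC ?muln1 //.
  by have /andP[_ /forallP] := tx.
rewrite big_mkcondr; apply: eq_bigr => l /eqP lE2; rewrite /A.
have [suppl|] := boolP (restrict_rep l == l); last first.
  move=> ns; have [x hx lx] : exists2 x, ~~ pair_rep x & l x != ord0.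
    apply/exists_inP; apply: contraNT ns; rewrite negb_exists_in => /forall_inP l0.
    apply/eqP/ffunP => x; rewrite ffunE; case: ifP => // /negbT /l0.
    by rewrite negbK => /eqP.
  rewrite [X in _ * X](bigD1 x) //= /z (negPf hx) expr0n.
  by rewrite (negPf (_ : (l x : nat) != 0%N)) // mul0r mulr0.
have [mu0 eL] := multinomial_bitsum lE2; rewrite bitsum_mersenne in eL.
have -> : (multinomial E2 (fun x => l x))%:R = (odd (multinomial E2 (fun x => l x)))%:R :> R.
  by rewrite pmulrn (intr_pchar2 _ ch2).
have -> : odd (multinomial E2 (fun x => l x)) = (\sum_x bitsum (l x) == m)%N.
  rewrite -eL -{2}[m]add0n eqn_add2r -[RHS]negbK -lt0n logn_gt0 mem_primes /=.
  by rewrite mu0 dvdn2 negbK.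
by case: eqP; rewrite ?mul1r ?mul0r.
Qed.
End Tight.

(** * The weight modulo 2 q *)

Section Lift.

Variables (F : finFieldType) (A : comNzRingType) (pi : {rmorphism A -> F}).
Variable (m : nat).
Hypotheses (m_gt0 : (0 < m)%N) (cF : #|F| = (2 ^ m)%N) (ch2 : 2%N \in [pchar F]).
Hypothesis pi_ker : forall a, pi a = 0 -> exists b, a = b *+ 2.
Hypothesis reg2 : forall a : A, a *+ 2 = 0 -> a = 0.

Definition eqmod2 (t : nat) (x y : A) : Prop := exists a, x = y + a *+ 2 ^ t.

Lemma eqmod2_refl t x : eqmod2 t x x.
Proof. by exists 0; rewrite mul0rn addr0. Qed.

Lemma eqmod2_sym t x y : eqmod2 t x y -> eqmod2 t y x.
Proof. by case=> a ->; exists (- a); rewrite mulNrn addrK. Qed.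

Lemma eqmod2_trans t y x z : eqmod2 t x y -> eqmod2 t y z -> eqmod2 t x z.
Proof. by case=> a -> [b ->]; exists (b + a); rewrite mulrnDl addrA. Qed.

Lemma eqmod2D t x x' y y' : eqmod2 t x x' -> eqmod2 t y y' -> eqmod2 t (x + y) (x' + y').
Proof. by case=> a -> [b ->]; exists (a + b); rewrite mulrnDl addrACA. Qed.

Lemma eqmod2M t x x' y y' : eqmod2 t x x' -> eqmod2 t y y' -> eqmod2 t (x * y) (x' * y').
Proof.
case=> a -> [b ->]; exists (x' * b + a * y' + a * (b *+ 2 ^ t)).
rewrite -(mulr_natr a) -(mulr_natr b) -(mulr_natr (_ + _)).
by move: (2 ^ t)%:R => q; ring.
Qed.

Lemma eqmod2X t n x y : eqmod2 t x y -> eqmod2 t (x ^+ n) (y ^+ n).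
Proof.
by move=> xy; elim: n => [|n IH]; [exact: eqmod2_refl | rewrite !exprS; apply: eqmod2M].
Qed.

Lemma eqmod2_sum t (J : finType) (P : pred J) (f g : J -> A) :
  (forall j, P j -> eqmod2 t (f j) (g j)) ->
  eqmod2 t (\sum_(j | P j) f j) (\sum_(j | P j) g j).
Proof.
move=> fg; apply: (big_ind2 (eqmod2 t)) => //; first exact: eqmod2_refl.
by move=> *; apply: eqmod2D.
Qed.

Lemma eqmod2_mulrn0 t s (x : A) : (t <= s)%N -> eqmod2 t (x *+ 2 ^ s) 0.
Proof.
by move=> ts; exists (x *+ 2 ^ (s - t)); rewrite add0r -mulrnA -expnD subnK.
Qed.

(** If x = y + 2 ^ t a then x ^ 2 = y ^ 2 modulo 2 ^ (t + 1), as soon as t > 0. *)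
Lemma eqmod2_frobenius s x y : pi x = pi y -> eqmod2 s.+1 (x ^+ (2 ^ s)) (y ^+ (2 ^ s)).
Proof.
move=> pxy; elim: s => [|s [a IH]].
  have [|b xb] := @pi_ker (x - y); first by rewrite rmorphB pxy subrr.
  by exists b; rewrite !expr1 expn1 -xb addrC subrK.
exists (a * y ^+ (2 ^ s) + a ^+ 2 * (2 ^ s)%:R).
rewrite expnSr !exprM IH -(mulr_natr a) -(mulr_natr (_ + _)) !expnS !natrM.
by move: (2 ^ s)%:R (y ^+ (2 ^ s)) => q w; ring.
Qed.

Lemma mulrn_exp2_inj t (x y : A) : x *+ 2 ^ t = y *+ 2 ^ t -> x = y.
Proof.
move=> xy; apply/subr0_eq; have : (x - y) *+ 2 ^ t = 0 by rewrite mulrnBl xy subrr.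
elim: t (x - y) {xy} => // t IH z.
by rewrite expnS mulrnA => /IH/reg2.
Qed.

(** The element u is a unit modulo 2, hence modulo every power of 2. *)
Lemma eqmod2_unit_cancel t (u s : A) : pi u != 0 -> eqmod2 t (u * s) 0 -> eqmod2 t s 0.
Proof.
move=> pu; elim: t s => [|t IH] s; first by exists s; rewrite add0r.
case=> a; rewrite add0r => us.
have [|b sb] := @pi_ker s.
  apply: (mulfI pu); rewrite mulr0 -rmorphM us expnS mulrnA mulrnAC.
  by rewrite rmorphMn /= mulr2n addrr_pchar2.
have [|c bc] := IH b.
  exists a; rewrite add0r; apply: (@mulrn_exp2_inj 1%N).
  by rewrite -mulrnAr -sb us -mulrnA expnSr.
by exists c; rewrite sb bc !add0r -mulrnA expnSr.
Qed.

Lemma dvdn_exp2_lift t (w : nat) (a : A) :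
  w%:R = a *+ 2 ^ t -> exists2 w', w = (2 ^ t * w')%N & w'%:R = a.
Proof.
move=> wa; suff [w' wE] : exists w', w = (2 ^ t * w')%N.
  exists w' => //; apply: (@mulrn_exp2_inj t).
  by rewrite -wa wE natrM mulr_natl.
elim: t a wa => [|t IH] a wa; first by exists w; rewrite mul1n.
have [|w' wE] := IH (a *+ 2); first by rewrite -mulrnA -expnS.
have /(congr1 pi) : w'%:R = a *+ 2.
  apply: (@mulrn_exp2_inj t).
  by rewrite -[RHS]mulrnA -expnS -wa wE natrM mulr_natl.
rewrite rmorph_nat rmorphMn /= mulr2n addrr_pchar2 // => /eqP.
rewrite -(dvdn_pcharf ch2) => /dvdnP[w2 w'E].
by exists w2; rewrite wE w'E expnSr mulnAC mulnA.
Qed.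

Lemma expr_card_exp2 (x : F) : x ^+ (2 ^ m) = x.
Proof. by rewrite -cF expf_card. Qed.

Variable lam : F -> A.
Hypothesis lamK : forall x, pi (lam x) = x.

(** An approximation of the Teichmueller representative: multiplicative modulo
    2 ^ (m + 1), which is all the precision needed. *)
Definition teich (x : F) : A := lam x ^+ (2 ^ m).

Lemma pi_teich x : pi (teich x) = x.
Proof. by rewrite rmorphXn /= lamK expr_card_exp2. Qed.

Lemma teichM x y : eqmod2 m.+1 (teich (x * y)) (teich x * teich y).
Proof.
rewrite /teich -exprMn; apply: eqmod2_frobenius.
by rewrite rmorphM !lamK.
Qed.

Definition power_sum (d : nat) : A := \sum_x teich x ^+ d.

Lemma power_sum0 : power_sum 0 = 1 *+ 2 ^ m.
Proof. by rewrite /power_sum sumr_const -cF. Qed.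

Lemma pi_power_sum d : (0 < d)%N -> (2 ^ m - 1 %| d)%N -> pi (power_sum d) = 1.
Proof.
move=> d0 /dvdnP[r dE]; rewrite rmorph_sum (bigD1 0) //= rmorphXn /= pi_teich.
rewrite expr0n (gtn_eqF d0) add0r (eq_bigr (fun=> 1)) => [|x x0]; last first.
  rewrite rmorphXn /= pi_teich dE mulnC exprM.
  have -> : x ^+ (2 ^ m - 1) = 1; last by rewrite expr1n.
  apply: (mulfI x0); rewrite -exprS mulr1 subn1 prednK ?expn_gt0 //.
  exact: expr_card_exp2.
rewrite sumr_const cardC1 cF.
have q0 : (2 ^ m)%:R = 0 :> F.
  by rewrite -(prednK m_gt0) natrX exprS (pcharf0 ch2) mul0r.
apply/eqP; rewrite -subr_eq0 -[(_).-1%:R](addrK 1) natr1 prednK ?expn_gt0 // q0.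
by rewrite sub0r -opprD oppr_eq0 addrr_pchar2.
Qed.

(** Multiplying the points by a generator g multiplies the sum by teich g ^ d, and
    g ^ d <> 1 in F. *)
Lemma power_sum_ndvd d : ~~ (2 ^ m - 1 %| d)%N -> eqmod2 m.+1 (power_sum d) 0.
Proof.
move=> nd; have [g gprim _] := finfield_generator F.
have g0 : g != 0.
  have := prim_expr_order gprim; apply: contra_eq_neq => ->.
  by rewrite expr0n (gtn_eqF (prim_order_gt0 gprim)) eq_sym oner_eq0.
have gd : g ^+ d != 1.
  by rewrite -(prim_order_dvd gprim) cF -subn1.
apply: (@eqmod2_unit_cancel _ (teich g ^+ d - 1)).
  by rewrite rmorphB rmorphXn /= pi_teich rmorph1 subr_eq0.
rewrite mulrBl mul1r -(subrr (power_sum d)).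
apply: eqmod2D; last exact: eqmod2_refl.
rewrite [X in eqmod2 _ _ X]/power_sum (reindex_inj (mulfI g0)) /= mulr_sumr.
apply: eqmod2_sum => x _; rewrite -exprMn; apply/eqmod2X/eqmod2_sym/teichM.
Qed.

Variables (I : finType) (n k : nat) (e : I -> 'I_n -> nat) (c : I -> F).
Hypotheses (k_gt1 : (1 < k)%N) (nk : n = k.*2).
Hypothesis deg_le : forall y, (\sum_i e y i <= k)%N.

Local Notation E := ((2 ^ m - 1) * 2 ^ m)%N.

Lemma E_gt0 : (0 < E)%N.
Proof.
by rewrite muln_gt0 expn_gt0 andbT subn_gt0 -{1}(expn0 2) ltn_exp2l.
Qed.

Definition peval (x : 'I_n -> F) : F := \sum_y c y * \prod_i x i ^+ e y i.

Definition lift_eval (x : 'I_n -> F) : A :=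
  \sum_y lam (c y) * \prod_i teich (x i) ^+ e y i.

Lemma pi_lift_eval x : pi (lift_eval x) = peval x.
Proof.
rewrite rmorph_sum; apply: eq_bigr => y _; rewrite rmorphM rmorph_prod lamK.
by congr (_ * _); apply: eq_bigr => i _; rewrite rmorphXn /= pi_teich.
Qed.

Lemma lift_eval_indicator x : eqmod2 m.+1 (lift_eval x ^+ E) (peval x != 0)%:R.
Proof.
have M0 : (0 < 2 ^ m - 1)%N by move: E_gt0; rewrite muln_gt0 => /andP[].
have -> : (peval x != 0)%:R = (peval x != 0)%:R ^+ (2 ^ m) :> A.
  by case: eqP; rewrite ?expr1n ?expr0n ?expn_eq0.
rewrite exprM; apply: eqmod2_frobenius; rewrite rmorph_nat rmorphXn /= pi_lift_eval.
have [->|x0] := eqVneq; first by rewrite expr0n (gtn_eqF M0).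
apply: (mulfI x0); rewrite -exprS mulr1 subn1 prednK ?expn_gt0 //.
exact: expr_card_exp2.
Qed.

Definition expansion_term (j : I -> nat) : A :=
  (multinomial E j)%:R * \prod_y lam (c y) ^+ j y * \prod_i power_sum (expo e j i).

(** After expanding, the sum over the points factors into one power sum for each variable. *)
Lemma sum_lift_eval :
  \sum_(x : {ffun 'I_n -> F}) lift_eval x ^+ E
  = \sum_(j : {ffun I -> 'I_E.+1} | (\sum_y j y == E)%N)
      expansion_term (fun y => j y).
Proof.
under eq_bigr do rewrite (multinomial_expansion _ (leqnn _)).
rewrite exchange_big; apply: eq_bigr => j _ /=.
rewrite /expansion_term -mulrA -mulr_sumr; congr (_ * _).
have -> : \prod_i power_sum (expo e (fun y => j y) i)
    = \sum_(x : {ffun 'I_n -> F}) \prod_i teich (x i) ^+ expo e (fun y => j y) i.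
  by rewrite bigA_distr_bigA.
rewrite mulr_sumr; apply: eq_bigr => x _.
under eq_bigr do rewrite exprMn.
rewrite big_split /=; congr (_ * _).
under eq_bigr do rewrite -prodrXl.
rewrite exchange_big; apply: eq_bigr => i _ /=.
rewrite /expo expr_sum; apply: eq_bigr => y _.
by rewrite -exprM; congr (_ ^+ _); apply: mulnC.
Qed.

(** The valuation of a term is at least the number of digits of j minus m, plus m for
    each variable with exponent zero; [tight_or_small] compares it to m + 1. *)
Lemma expansion_term_mod (j : I -> nat) : (\sum_y j y = E)%N ->
  exists2 u, eqmod2 m.+1 (expansion_term j) (u *+ 2 ^ m)
    & pi u = if tight m e j then \prod_y c y ^+ j y else 0.
Proof.
move=> jE; have [/forallP all_dvd|] :=
  boolP [forall i, (2 ^ m - 1 %| expo e j i)%N]; last first.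
  rewrite negb_forall => /existsP[i ni]; exists 0.
    rewrite mul0rn -(mulr0 ((multinomial E j)%:R * \prod_y lam (c y) ^+ j y)).
    apply: eqmod2M; first exact: eqmod2_refl.
    rewrite (bigD1 i) //= -(mul0r (\prod_(l | l != i) power_sum (expo e j l))).
    by apply: eqmod2M (eqmod2_refl _ _); apply: power_sum_ndvd.
  rewrite rmorph0 ifN //; apply: contra ni => /andP[_ /forallP/(_ i)].
  by case/andP.
have [mu0 mu_log] := multinomial_bitsum jE.
rewrite bitsum_mersenne in mu_log.
have [v v_odd muE] := pfactor_coprime (isT : prime 2) mu0.
rewrite coprime2n in v_odd.
pose z := #|[pred i | expo e j i == 0%N]|.
pose rho := \prod_(i | expo e j i != 0%N) power_sum (expo e j i).
have pi_rho : pi rho = 1.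
  by rewrite rmorph_prod big1 // => i; rewrite -lt0n => e0; apply: pi_power_sum.
pose u := v%:R * \prod_y lam (c y) ^+ j y * rho.
have termE : expansion_term j = u *+ 2 ^ (logn 2 (multinomial E j) + m * z).
  rewrite /expansion_term {1}muE (bigID (fun i => expo e j i == 0%N)) /= -/rho.
  rewrite [\prod_(i | expo e j i == 0%N) _](eq_bigr (fun=> 1 *+ 2 ^ m));
    last by move=> i /eqP->; exact: power_sum0.
  rewrite prodr_const -/z -(mulr_natr u) expnD expnM !natrM !natrX /u.
  move: (v%:R) (\prod_y _) (2%:R ^+ logn _ _) (2%:R ^+ m ^+ z) => ? ? ? ?.
  ring.
have pi_u : pi u = \prod_y c y ^+ j y.
  rewrite /u !rmorphM pi_rho mulr1 rmorph_nat rmorph_prod.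
  have -> : v%:R = 1 :> F by rewrite pmulrn (intr_pchar2 _ ch2) /= v_odd.
  by rewrite mul1r; apply: eq_bigr => y _; rewrite rmorphXn /= lamK.
have := tight_or_small m_gt0 k_gt1 nk deg_le (fun i _ => all_dvd i).
rewrite -/z; case tj: (tight m e j) => /= small; last first.
  exists 0; last by rewrite rmorph0.
  rewrite mul0rn termE; apply: eqmod2_mulrn0.
  by move: mu_log small; rewrite -/z; lia.
have z0 : z = 0%N.
  apply: eq_card0 => i; rewrite inE; apply/negbTE; rewrite -lt0n.
  by case/andP: tj => _ /forallP/(_ i)/andP[].
exists u => //; rewrite termE z0 muln0 addn0.
have -> : logn 2 (multinomial E j) = m; last exact: eqmod2_refl.
by case/andP: tj => /eqP W _; move: mu_log; rewrite W; lia.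
Qed.

Variables (tau : I -> I) (i0 : 'I_n).
Hypotheses (e_inj : forall x y, e x =1 e y -> x = y) (tauK : involutive tau).
Hypothesis e_tau : forall x i, sqfree_top k e x -> e (tau x) i = (1 - e x i)%N.

(** In A the size of the support is 2 ^ m V with V reducing to Q(c) ^ (E / 2) in
    F, so that one more factor 2 divides it exactly when Q(c) = 0. *)
Lemma dvdn_card_support :
  (2 ^ m.+1 %| #|[set x : {ffun 'I_n -> F} | peval x != 0%R]|)%N
  = (\sum_(y | pair_rep k e i0 y) c y * c (tau y) == 0).
Proof.
set w := #|_|.
have wE : w%:R = \sum_(x : {ffun 'I_n -> F}) (peval x != 0)%:R :> A.
  rewrite /w -sum1_card natr_sum big_mkcond; apply: eq_bigr => x _.
  by rewrite inE; case: (peval x != 0).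
pose P (j : {ffun I -> 'I_E.+1}) (u : A) := (\sum_y j y == E)%N ->
  eqmod2 m.+1 (expansion_term (fun y => j y)) (u *+ 2 ^ m)
  /\ pi u = if tight m e (fun y => j y) then \prod_y c y ^+ j y else 0.
have [|U UP] := @fin_all_exists _ _ P.
  move=> j; case: (boolP (\sum_y j y == E)%N) => [/eqP jE|nj]; last first.
    by exists 0; rewrite /P (negPf nj).
  by have [u] := expansion_term_mod jE; exists u.
have [a wa] : eqmod2 m.+1 w%:R
    ((\sum_(j : {ffun I -> 'I_E.+1} | (\sum_y j y == E)%N) U j) *+ 2 ^ m).
  rewrite wE; apply: (@eqmod2_trans _ (\sum_(x : {ffun 'I_n -> F}) lift_eval x ^+ E)).
    by apply: eqmod2_sum => x _; apply/eqmod2_sym/lift_eval_indicator.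
  rewrite sum_lift_eval -sumrMnl; apply: eqmod2_sum => j jE.
  by have [] := UP j jE.
have {wa}wa : w%:R = (\sum_(j : {ffun I -> 'I_E.+1} | (\sum_y j y == E)%N) U j
    + a *+ 2) *+ 2 ^ m by rewrite wa mulrnDl expnS mulrnA.
have [w' -> w'E] := dvdn_exp2_lift wa.
rewrite expnSr dvdn_pmul2l ?expn_gt0 // (dvdn_pcharf ch2).
rewrite -(rmorph_nat pi) w'E rmorphD rmorphMn /= [X in _ + X]mulr2n addrr_pchar2 //.
rewrite addr0 rmorph_sum.
rewrite (eq_bigr (fun j : {ffun I -> 'I_E.+1} =>
  if tight m e (fun y => j y) then \prod_y c y ^+ j y else 0)); last first.
  by move=> j jE; have [] := UP j jE.
rewrite -big_mkcondr /= (tight_sum m_gt0 k_gt1 nk deg_le e_inj tauK e_tau i0 c ch2 cF).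
rewrite expf_eq0 muln_gt0 expn_gt0 andbT subn_gt0 -{1}(expn0 2) ltn_exp2l //.
by rewrite m_gt0.
Qed.

End Lift.

(** * Zeros of a hyperbolic quadratic form *)

Section PairingZeros.

Variables (F : finFieldType) (K : finType) (H : pred K) (tau : K -> K).
Hypotheses (tau_inj : injective tau) (H_tau : forall x, H x -> ~~ H (tau x)).

Definition pairing (c : {ffun K -> F}) : F := \sum_(x | H x) c x * c (tau x).

Definition pivot (c : {ffun K -> F}) : option K := [pick x | H x && (c x != 0)].

Lemma pivotE (c : {ffun K -> F}) : pivot c = [exists x, H x && (c x != 0)] :> bool.
Proof.
rewrite /pivot; case: (pickP (fun x => H x && (c x != 0))) => [x Hx|none].
  by apply/esym/existsP; exists x.
by apply/esym/existsP => -[x]; rewrite none.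
Qed.

(** The form is affine in the coordinate tau x, with slope c x; moving
    this coordinate adds any prescribed t to the value of the form. *)
Definition shift (t : F) (c : {ffun K -> F}) : {ffun K -> F} :=
  if pivot c is Some x
  then [ffun y => c y + if y == tau x then t / c x else 0] else c.

Lemma shift_off (t : F) (c : {ffun K -> F}) (y : K) : H y -> shift t c y = c y.
Proof.
rewrite /shift /pivot => Hy; case: pickP => [x /andP[/H_tau Hx _]|//].
rewrite ffunE ifN ?addr0 //; apply: contraNneq Hx => <-; exact: Hy.
Qed.

Lemma pivot_shift (t : F) (c : {ffun K -> F}) : pivot (shift t c) = pivot c.
Proof.
by apply: eq_pick => x; case Hx: (H x) => //=; rewrite shift_off.
Qed.

Lemma shiftK (t : F) : cancel (shift t) (shift (- t)).
Proof.
move=> c; rewrite {1}/shift pivot_shift.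
case px: (pivot c) => [x|]; last by rewrite /shift px.
have Hx : H x by move: px; rewrite /pivot; case: pickP => // y /andP[? _] [<-].
apply/ffunP => y; rewrite ffunE (shift_off t c Hx) /shift px ffunE.
by case: eqP; rewrite ?addr0 // mulNr addrK.
Qed.

Lemma pairing_shift (t : F) (c : {ffun K -> F}) :
  pivot c -> pairing (shift t c) = pairing c + t.
Proof.
case px: (pivot c) => [x|//] _.
have [Hx cx] : H x /\ c x != 0.
  by move: px; rewrite /pivot; case: pickP => // y /andP[? ?] [<-].
rewrite /pairing (bigD1 x) // [in RHS](bigD1 x) //= shift_off // addrAC.
congr (_ + _); last first.
  apply: eq_bigr => y /andP[Hy yx]; rewrite shift_off //; congr (_ * _).
  by rewrite /shift px ffunE (inj_eq tau_inj) (negPf yx) addr0.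
by rewrite /shift px ffunE eqxx mulrDr mulrCA divff // mulr1.
Qed.

Lemma card_pairing_fiber (y : F) :
  #|[set c | pivot c && (pairing c == y)]| = #|[set c | pivot c && (pairing c == 0)]|.
Proof.
have le a b : (#|[set c | pivot c && (pairing c == a)]|
    <= #|[set c | pivot c && (pairing c == b)]|)%N.
  rewrite -(card_imset _ (can_inj (shiftK (b - a)))); apply/subset_leq_card/subsetP.
  move=> _ /imsetP[c + ->]; rewrite !inE pivot_shift => /andP[pc /eqP ca].
  by rewrite pc pairing_shift // ca addrC subrK /=.
by apply/anti_leq; rewrite !le.
Qed.

Lemma card_no_pivot : #|[set c : {ffun K -> F} | ~~ pivot c]| = (#|F| ^ (#|K| - #|H|))%N.
Proof.
have <- : #|[predC H]| = (#|K| - #|H|)%N by rewrite -(cardC H) addKn.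
rewrite -(card_pffun_on 0 [predC H] predT).
apply: eq_card => c; rewrite inE; apply/idP/pffun_onP => [nc|[/supportP sup _]].
  split=> [|//]; apply/supportP => x; rewrite inE negbK => Hx.
   by move: nc; rewrite pivotE negb_exists => /forallP/(_ x); rewrite (Hx : H x) negbK => /eqP.
rewrite pivotE negb_exists; apply/forallP => x; rewrite negb_and negbK orbC.
case Hx: (H x); rewrite ?orbT // orbF; apply/eqP/sup.
by rewrite inE negbK; exact: Hx.
Qed.

(** Among the vectors that do not vanish on H the form is equidistributed
    ([card_pairing_fiber]); it is zero on those that do. *)
Lemma card_pairing_zeros :
  (#|[set c : {ffun K -> F} | pairing c == 0%R]| * #|F| + #|F| ^ (#|K| - #|H|)
    = #|F| ^ #|K| + #|F| ^ (#|K| - #|H|) * #|F|)%N.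
Proof.
rewrite -card_no_pivot -(card_ffun K F); set Z := [set c | ~~ _].
pose N0 := [set c | pivot c && (pairing c == 0)].
have eZ : #|[set c | pairing c == 0]| = (#|Z| + #|N0|)%N.
  rewrite -(cardsID Z); congr (_ + _)%N; apply: eq_card => c; rewrite !inE.
    rewrite andbC; case: (boolP (~~ pivot c)) => //= nc.
    apply/eqP; rewrite /pairing big1 // => x Hx.
    move: nc; rewrite pivotE negb_exists => /forallP/(_ x).
    by rewrite Hx negbK => /eqP->; rewrite mul0r.
  by rewrite negbK.
have eN : (#|N0| * #|F| + #|Z| = #|{ffun K -> F}|)%N.
  rewrite -[RHS]cardsT -[RHS](cardsID Z) setTI addnC; congr (_ + _)%N.
  rewrite setTD -[RHS]sum1_card [RHS](partition_big pairing xpredT) //=.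
  rewrite -[LHS]mulnC -sum_nat_const; apply: eq_bigr => y _.
  rewrite -(card_pairing_fiber y) -sum1_card; apply: eq_bigl => c.
  by rewrite !inE negbK.
by rewrite eZ -eN; ring.
Qed.

End PairingZeros.

(** * Vectors with bounded entries and bounded sum *)

Section BoundedVectors.

(** The power series of (1 - X) ^ - (n + 1), truncated at degree L. *)
Definition geom_pow (n L : nat) : {poly int} := \poly_(t < L) ('C(n + t, n))%:Z.

Lemma geom_pow_step (n L : nat) :
  (1 - 'X) * geom_pow n.+1 L = geom_pow n L - ('C(n + L, n.+1))%:Z *: 'X^L.
Proof.
rewrite /geom_pow !poly_def; elim: L => [|L IH].
  by rewrite !big_ord0 mulr0 addn0 bin_small // scale0r subrr.
rewrite !big_ord_recr /= mulrDr IH addnS addSn binS.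
rewrite -!mul_polyC !PoszD !rmorphD /= exprS.
by move: (\sum_(i < L) _) => S; ring.
Qed.

Lemma coef_mul_geom_pow (p : {poly int}) (n k L : nat) : (k < L)%N ->
  (p * geom_pow 0 L)`_k = (p * (1 - 'X) ^+ n * geom_pow n L)`_k.
Proof.
move=> kL; elim: n => [|n IH]; first by rewrite expr0 mulr1.
rewrite IH -[geom_pow n L](subrK (('C(n + L, n.+1))%:Z *: 'X^L)) -geom_pow_step.
rewrite mulrDr coefD -scalerAr coefZ coefMXn kL mulr0 addr0 exprSr.
by rewrite !mulrA.
Qed.

(** The count is the coefficient of X ^ k in (1 + X + ... + X ^ (q - 1)) ^ n / (1 - X),
    that is, in (1 - X ^ q) ^ n / (1 - X) ^ (n + 1). *)
Lemma card_bounded_vectors (q n k : nat) : (0 < q)%N ->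
  #|[set v : {ffun 'I_n -> 'I_q} | \sum_i v i <= k]%N|%:Z
  = \sum_(0 <= j < (k %/ q).+1) (-1) ^+ j * ('C(n, j) * 'C(n + k - q * j, n))%:Z.
Proof.
move=> q0; pose p : {poly int} := \sum_(v < q) 'X^v.
have pn : p ^+ n = \sum_(v : {ffun 'I_n -> 'I_q}) 'X^(\sum_i v i).
  rewrite -[in LHS](card_ord n) -prodr_const bigA_distr_bigA /=.
  by apply: eq_bigr => v _; rewrite expr_sum.
have p1 : p * (1 - 'X) = 1 - 'X^q.
  by rewrite -[1 - 'X]opprB -[1 - 'X^q]opprB subrX1 mulrN mulrC.
have -> : #|[set v : {ffun 'I_n -> 'I_q} | \sum_i v i <= k]%N|%:Z
    = (p ^+ n * geom_pow 0 k.+1)`_k.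
  rewrite pn mulr_suml coef_sum -sum1_card -natz natr_sum big_mkcond /=.
  apply: eq_bigr => v _; rewrite inE coefXnM ltnNge; case: ifP => //= vk.
  by rewrite coef_poly ltnS leq_subr bin0.
rewrite (coef_mul_geom_pow _ n (ltnSn k)) -exprMn p1 exprDn mulr_suml coef_sum.
pose G (i : nat) : int := (-1) ^+ i * ('C(n, i) * 'C(n + k - q * i, n))%:Z.
rewrite (eq_bigr (fun i : 'I_n.+1 => if (i <= k %/ q)%N then G i else 0)); last first.
  move=> i _; rewrite expr1n mul1r exprNn -exprM mulrnAl coefMn -mulrA.
  have -> : (-1) ^+ i = ((-1) ^+ i)%:P :> {poly int} by rewrite rmorphXn rmorphN1.
  rewrite coefCM coefXnM coef_poly leq_divRL // mulnC.
  case: (leqP (i * q) k) => ik; last by rewrite mulr0 mul0rn.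
  rewrite ltnS leq_subr /G -mulrnAr PoszM mulnC addnBA; last by rewrite mulnC.
  by rewrite -mulr_natl natz.
(* The two ranges differ: the terms with i > n vanish through 'C(n, i), and those
   with q i > k are absent from both sides. *)
pose M := maxn n (k %/ q).
rewrite (big_ord_widen M.+1 (fun i => if (i <= k %/ q)%N then G i else 0)) ?ltnS ?leq_maxl //.
rewrite big_mkord (big_ord_widen M.+1 G) ?ltnS ?leq_maxr //.
rewrite big_mkcond [RHS]big_mkcond; apply: eq_bigr => i _; rewrite !ltnS.
have [//|ni] := leqP i n; case: ifP => // _.
by rewrite /G bin_small // mulr0.
Qed.
End BoundedVectors.

(** * Codewords and their coefficients *)

Section ReedMullerCoefficients.

Variables (F : finFieldType) (d n : nat).

Local Notation K := (rm_mnm F d n).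

Definition mexp (y : K) (i : 'I_n) : nat := bmnm (val y) i.

Lemma mexp_inj (y z : K) : mexp y =1 mexp z -> y = z.
Proof. by move=> yz; apply/val_inj/val_inj/mnmP. Qed.

Lemma sum_mexp (y : K) : (\sum_i mexp y i = mdeg (bmnm (val y)))%N.
Proof. by rewrite mdegE. Qed.

Lemma sum_mexp_le (y : K) : (\sum_i mexp y i <= d)%N.
Proof. by rewrite sum_mexp -ltnS; apply: bmdeg. Qed.

Lemma mexp_lt (y : K) (i : 'I_n) : (mexp y i < #|F|)%N.
Proof.
have /forallP/(_ i) := valP y; rewrite -ltnS prednK //.
by apply/card_gt0P; exists 0.
Qed.

Lemma mexp_surj (v : 'I_n -> nat) :
  (\sum_i v i <= d)%N -> (forall i, v i < #|F|)%N -> exists y : K, mexp y =1 v.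
Proof.
move=> vd vq; pose mv := [multinom v i | i < n].
have mvd : (mdeg mv < d.+1)%N.
  by rewrite mdegE ltnS (leq_trans _ vd) // leq_sum // => i _; rewrite mnmE.
have mvq : [forall j : 'I_n, (BMultinom mvd j <= #|F|.-1)%N].
  apply/forallP => j; rewrite -ltnS prednK ?mnmE //.
  by apply/card_gt0P; exists 0.
by exists (exist _ (BMultinom mvd) mvq) => i; rewrite /mexp /= mnmE.
Qed.

Definition coefs (f : reed_muller F d n) : {ffun K -> F} :=
  [ffun y => (rm_poly f)@_(bmnm (val y))].

Lemma rm_poly_coefs (f : reed_muller F d n) :
  rm_poly f = \sum_(y : K) coefs f y *: 'X_[bmnm (val y)].
Proof.
have bmnm_inj : injective (fun y : K => bmnm (val y)) by move=> y z /val_inj/val_inj.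
apply/mpolyP => mo; rewrite raddf_sum /=.
have [/existsP[y /eqP->]|/existsPn no] := boolP [exists y : K, mo == bmnm (val y)].
  rewrite (bigD1 y) //= mcoeffZ mcoeffX eqxx mulr1 ffunE big1 ?addr0 // => z zy.
  by rewrite mcoeffZ mcoeffX (inj_eq bmnm_inj) (negPf zy) mulr0.
rewrite big1 => [|y _]; last by rewrite mcoeffZ mcoeffX eq_sym (negPf (no y)) mulr0.
apply/memN_msupp_eq0/negP => mf.
have [dm jm] := elimT (rm_predP d _) (valP f) mo mf.
by have := no (exist _ (BMultinom dm) jm); rewrite eqxx.
Qed.

Lemma coefs_bij : bijective coefs.
Proof.
have bmnm_inj : injective (fun y : K => bmnm (val y)) by move=> y z /val_inj/val_inj.
pose p (c : {ffun K -> F}) := \sum_(y : K) c y *: 'X_[bmnm (val y)] : {mpoly F[n]}.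
have pP c : p c \in rm_pred F d n.
  apply: rpred_sum => y _; apply: rpredZ; apply/rm_predP => mo.
  by rewrite msuppX inE => /eqP->; split; [exact: bmdeg | exact: (valP y)].
exists (fun c => ReedMuller (pP c)) => [f|c].
  by apply: val_inj; rewrite /= [RHS]rm_poly_coefs.
apply/ffunP => y; rewrite ffunE /= /p raddf_sum /= (bigD1 y) //= mcoeffZ mcoeffX.
rewrite eqxx mulr1 big1 ?addr0 // => z zy.
by rewrite mcoeffZ mcoeffX (inj_eq bmnm_inj) (negPf zy) mulr0.
Qed.

Lemma weight_coefs (f : reed_muller F d n) :
  weight f = #|[set x : {ffun 'I_n -> F} | peval mexp (coefs f) x != 0]|.
Proof.
rewrite /weight; have <- : #|[set: {ffun 'I_n -> F}]| = (#|F| ^ n)%N.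
  by rewrite cardsT card_ffun card_ord.
rewrite -(cardsID (zeros f)) setTI addKn.
rewrite setTD; apply: eq_card => x; rewrite !inE; congr (_ != 0).
rewrite /= [in LHS]rm_poly_coefs raddf_sum; apply: eq_bigr => y _.
by rewrite /= mevalZ mevalX.
Qed.

Lemma dim_reed_muller : \dim {: reed_muller F d n} = #|{: K}|.
Proof. by rewrite dimvf. Qed.

Lemma card_rm_mnm :
  #|{: K}| = #|[set v : {ffun 'I_n -> 'I_#|F|} | \sum_i v i <= d]%N|.
Proof.
pose g (y : K) := [ffun i => Ordinal (mexp_lt y i)].
have g_inj : injective g.
  move=> y z /ffunP gyz; apply: mexp_inj => i.
  by have := congr1 val (gyz i); rewrite !ffunE.
rewrite -cardsT -(card_imset _ g_inj); apply: eq_card => v; rewrite inE.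
apply/imsetP/idP => [[y _ ->]|vd].
  by rewrite (leq_trans _ (sum_mexp_le y)) // leq_sum // => i _; rewrite ffunE.
have [y yv] := mexp_surj vd (fun i => ltn_ord (v i)).
by exists y => //; apply/ffunP => i; apply: val_inj; rewrite ffunE /= yv.
Qed.

End ReedMullerCoefficients.

(** * Complementary monomials *)

Section Complement.

Variables (F : finFieldType) (k n : nat).
Hypothesis nk : n = k.*2.

Local Notation K := (rm_mnm F k n).
Local Notation e := (@mexp F k n).

(** As n = 2 k, the complement of a squarefree monomial of degree k has again degree
    k, so it belongs to the code; all other monomials are fixed. *)
Lemma complement_exists :
  exists tau : K -> K, involutive tau
    /\ forall y i, sqfree_top k e y -> e (tau y) i = (1 - e y i)%N.
Proof.
pose compl (y : K) := odflt y [pick z : K | [forall i, e z i == 1 - e y i]%N].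
pose tau y := if sqfree_top k e y then compl y else y.
have e_tau y i : sqfree_top k e y -> e (tau y) i = (1 - e y i)%N.
  rewrite /tau /compl => ty; rewrite ty; case: pickP => [z /forallP/(_ i)/eqP //|no].
  have [| |z ez] := @mexp_surj F k n (fun i => 1 - e y i)%N.
  - have /andP[/eqP dy /forallP le1] := ty.
    by rewrite sumnB // dy sum1_card card_ord nk -addnn addnK.
  - by move=> l; rewrite (leq_ltn_trans (leq_subr _ _)) // finNzRing_gt1.
  by have /forallP[] := no z; move=> l; apply/eqP.
exists tau; split=> // y; case ty: (sqfree_top k e y); last by rewrite /tau ty ty.
apply: mexp_inj => i.
have tty : sqfree_top k e (tau y) by apply: sqfree_top_tau.
rewrite !e_tau //; have /andP[_ /forallP/(_ i)] := ty.
by case: (e y i) => [|[]].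
Qed.

Lemma card_sqfree_top : #|[pred y : K | sqfree_top k e y]| = 'C(n, k).
Proof.
have <- : #|[set B : {set 'I_n} | #|B| == k]| = 'C(n, k) by rewrite card_draws card_ord.
pose s (y : K) := [set i | e y i == 1%N].
have s_inj : {in [pred y | sqfree_top k e y] &, injective s}.
  move=> y z /andP[_ /forallP yl] /andP[_ /forallP zl] /setP syz.
  apply: mexp_inj => i; have := syz i; rewrite !inE.
  by case: (e y i) (yl i) => [|[]] //; case: (e z i) (zl i) => [|[]].
rewrite -(card_in_imset s_inj); apply: eq_card => B; rewrite inE.
apply/imsetP/eqP => [[y /andP[/eqP dy /forallP yl] ->]|cB].
  rewrite -dy -sum1_card big_mkcond; apply: eq_bigr => i _.
  by rewrite inE; case: (e y i) (yl i) => [|[]].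
have [| |y ey] := @mexp_surj F k n (fun i => i \in B : nat).
- rewrite -cB -sum1_card [X in (_ <= X)%N]big_mkcond; apply: leq_sum => i _.
  by case: (i \in B).
- by move=> i; rewrite (leq_ltn_trans (leq_b1 _)) // finNzRing_gt1.
exists y; last by apply/setP => i; rewrite inE ey; case: (i \in B).
apply/andP; split; last by apply/forallP => i; rewrite ey leq_b1.
apply/eqP; rewrite -[RHS]cB -sum1_card [RHS]big_mkcond; apply: eq_bigr => i _.
by rewrite ey; case: (i \in B).
Qed.

End Complement.

(** * The number of codewords of weight divisible by 2 q *)

Lemma hyperbolic_count_eq (q N D h : nat) :
  (0 < q -> 0 < h -> h.*2 <= D ->
   N * q + q ^ (D - h) = q ^ D + q ^ (D - h) * q ->
   N = (q ^ (h.*2 - 1) + (q - 1) * q ^ (h - 1)) * q ^ (D - h.*2))%N.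
Proof.
move=> q0; case: h => [//|h] _ hD.
have [r ->] : exists r, D = (r + h.+1.*2)%N by exists (D - h.+1.*2)%N; rewrite subnK.
rewrite addnK -addnn.
have -> : (r + (h.+1 + h.+1) - h.+1 = r + h.+1)%N by lia.
have -> : (h.+1 + h.+1 - 1 = h.+1 + h)%N by lia.
have -> : (h.+1 - 1 = h)%N by lia.
rewrite !expnD !expnS; move: (q ^ r)%N (q ^ h)%N => a b eqN.
apply/eqP; rewrite -(eqn_pmul2r q0); apply/eqP.
case: q q0 eqN => // q _; rewrite subn1 /= => eqN.
by apply: (@addIn (a * (q.+1 * b))); rewrite eqN; ring.
Qed.

Theorem corollary3p3 (F : finFieldType) (m n : nat) (hm : (1 <= m)%N)
    (hq : #|F| = (2 ^ m)%N) (hn : (4 <= n)%N) (hev : ~~ odd n) :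
  let q := #|F| in
  let dimR := \dim {: reed_muller F n./2 n} in
  rm_count F n./2 n m.+1 =
    ((q ^ ('C(n, n./2) - 1) + (q - 1) * q ^ ('C(n, n./2)./2 - 1))
      * q ^ (dimR - 'C(n, n./2)))%N
  /\ dimR%:Z = \sum_(0 <= j < (n %/ (2 * q)).+1)
                 (-1) ^+ j * ('C(n, j) * 'C((3 * n)./2 - q * j, n))%:Z.
Proof.
move=> q dimR; set k := n./2.
have nk : n = k.*2 by rewrite -[LHS](odd_double_half n) (negPf hev).
have k_gt1 : (1 < k)%N by rewrite /k; lia.
have q_gt0 : (0 < q)%N by rewrite /q hq expn_gt0.
have dimE : dimR = #|{: rm_mnm F k n}| by exact: dim_reed_muller.
split; last first.
  rewrite dimE card_rm_mnm card_bounded_vectors // divnMA divn2 -/k.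
  by have -> : ((3 * n)./2 = n + k)%N by rewrite /k; lia.
have ch2 : 2%N \in [pchar F] by apply: card_finPcharP hq _.
have [tau [tauK e_tau]] := complement_exists F nk.
have i0 : 'I_n by apply: (@Ordinal n 0); lia.
have [A [pi [pi_surj pi_ker reg2]]] := integral_lift ch2.
have [lam lamK] := fin_all_exists pi_surj.
pose H := pair_rep k (@mexp F k n) i0.
have H_top y : H y -> sqfree_top k (@mexp F k n) y by case/andP.
have H_tau y : H y -> ~~ H (tau y).
  move=> Hy; rewrite /H (pair_rep_tau nk e_tau) ?H_top // negbK.
  exact: Hy.
have countE : rm_count F k n m.+1
    = #|[set c : {ffun rm_mnm F k n -> F} | pairing H tau c == 0]|.
  rewrite -(on_card_preimset (onW_bij _ (coefs_bij F k n))); apply: eq_card => f.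
  rewrite !inE -(dvdn_card_support hm hq ch2 pi_ker reg2 lamK (coefs f) k_gt1 nk
    (@sum_mexp_le F k n) i0 (@mexp_inj F k n) tauK e_tau).
  rewrite -weight_coefs /val_ge hq -(prednK hm) pdiv_pfactor // prednK //.
  have [->|w0] := posnP (weight f); first by rewrite dvdn0.
  by rewrite pfactor_dvdn.
have cardH : 'C(n, k) = #|H|.*2.
  rewrite -(card_sqfree_top F k n) -sum1_card big_mkcond.
  rewrite (big_pair_rep nk tauK e_tau i0 addn) => [|y /negPf ty]; last by rewrite inE ty.
  rewrite -muln2 -sum_nat_const; apply: eq_big => // y Hy.
  by rewrite !inE H_top // (sqfree_top_tau nk e_tau) ?H_top.
have := card_pairing_zeros F (inv_inj tauK) H_tau.
have Dle : ('C(n, k) <= dimR)%N by rewrite dimE -(card_sqfree_top F k n) max_card.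
have h0 : (0 < #|H|)%N by rewrite -double_gt0 -cardH bin_gt0 nk -addnn leq_addr.
rewrite -dimE -/q => zeros_eq; rewrite countE cardH doubleK.
by apply: (hyperbolic_count_eq q_gt0 h0 _ zeros_eq); rewrite -cardH.
Qed.
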